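(* There is an algorithm which, given integers $n\ge1$, $M\ge 0$ and a vector $a=(a_0,\dots,a_n)\in\mathbb{Z}^{n+1}$ with $0\le a_i\le M$ for $0\le i\le n$ and $a_0=a_n=0$, decides whether there exists a non-periodic tropical recurrent minimal sequence satisfying $a$. The complexity of the algorithm does not exceed $(Mn)^{O(n)}$.
   Context: A tropical recurrent sequence here is a sequence $y=(y_j)_{j\in\mathbb{Z}}$ of real numbers. It satisfies $a$ if for every $k\in\mathbb{Z}$ the minimum $\min_{0\le i\le n}\{a_i+y_{i+k}\}$ is attained for at least two different indices $i$. It is minimal if for every $j\in\mathbb{Z}$ there exists $k$ with $j-n\le k\le j$ such that $a_{j-k}+y_j=\min_{0\le i\le n}\{a_i+y_{i+k}\}$. The sequence is periodic if there is $d\ge1$ with $y_{j+d}=y_j$ for all $j\in\mathbb{Z}$; otherwise it is non-periodic. *)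

(* Defs.v *)
From Stdlib Require Import ZArith Reals.
From mathcomp Require Import all_boot.

Set Implicit Arguments.
Unset Strict Implicit.
Unset Printing Implicit Defensive.

Definition attains_min (n : nat) (a : nat -> Z) (y : Z -> R) (k : Z) (i : nat) : Prop :=
  (i <= n)%N /\
  forall l : nat, (l <= n)%N ->
    Rle (Rplus (IZR (a i)) (y (Z.of_nat i + k)%Z)) (Rplus (IZR (a l)) (y (Z.of_nat l + k)%Z)).

Definition tsatisfies (n : nat) (a : nat -> Z) (y : Z -> R) : Prop :=
  forall k : Z, exists i j : nat, i <> j /\ attains_min n a y k i /\ attains_min n a y k j.

Definition tminimal (n : nat) (a : nat -> Z) (y : Z -> R) : Prop :=
  forall j : Z, exists k : Z,
    (j - Z.of_nat n <= k)%Z /\ (k <= j)%Z /\ attains_min n a y k (Z.to_nat (j - k)).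

Definition tperiodic (y : Z -> R) : Prop :=
  exists d : Z, (1 <= d)%Z /\ forall j : Z, y (j + d)%Z = y j.

Record TM := MkTM {
  tm_state : finType;
  tm_sym : finType;
  tm_blank : tm_sym;
  tm_bit : bool -> tm_sym;
  tm_start : tm_state;
  (* None = halt; Some (q', s, true) = write s, move right; false = left *)
  tm_delta : tm_state -> tm_sym -> option (tm_state * tm_sym * bool);
  tm_accept : pred tm_state
}.

Definition config (m : TM) : Type := (tm_state m * (Z -> tm_sym m) * Z)%type.

Definition cstate (m : TM) (c : config m) : tm_state m := c.1.1.

Definition step (m : TM) (c : config m) : option (config m) :=
  let '(q, t, p) := c in
  match tm_delta q (t p) with
  | None => None
  | Some (q', s, d) =>
      Some (q', (fun z => if Z.eqb z p then s else t z),
            (if d then (p + 1)%Z else (p - 1)%Z))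
  end.

Fixpoint run (m : TM) (fuel : nat) (c : config m) : option (config m) :=
  match step c with
  | None => Some c
  | Some c' => match fuel with 0 => None | S f => run f c' end
  end.

Definition init (m : TM) (w : seq bool) : config m :=
  (tm_start m,
   (fun z => if (0 <=? z)%Z && (z <? Z.of_nat (size w))%Z
             then tm_bit m (nth false w (Z.to_nat z)) else tm_blank m),
   0%Z).

Definition unary (k : nat) : seq bool := rcons (nseq k true) false.

Definition encode (n M : nat) (a : nat -> Z) : seq bool :=
  unary n ++ unary M ++ flatten [seq unary (Z.to_nat (a i)) | i <- iota 0 n.+1].

(* Main.v *)
(* With 0 <= a_i <= M and a_0 = a_n = 0, the minimum of a solution over n
   consecutive terms is constant, so an integer minimal solution takes values in
   an interval of length M. Hence these solutions are the bi-infinite paths of a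
   finite graph on the words of length 2n+1 over {0, ..., M}. Trim it to the
   vertices lying on bi-infinite paths. If a trimmed vertex has two predecessors,
   two integer solutions agree on a right half-line but not everywhere, so one of
   them is not periodic. Otherwise taking predecessors permutes the trimmed
   vertices and all integer solutions share a period D; for a real solution y and
   every real c, the sequence floor(y + c) is again an integer solution, so it has
   period D, and therefore so has y.

   The trimming is written in a small imperative language with registers bounded
   by K and bit arrays, whose running time is polynomial in K by the shape of the
   program, and compiled to a Turing machine whose tape carries one track per
   array and one mark per register. *)
Require Import Defs.
From Stdlib Require Import ZArith Reals.
From mathcomp Require Import all_boot.
From HB Require Import structures.
From Stdlib Require Import Classical FunctionalExtensionality Lra.
From mathcomp Require Import zify.

Set Implicit Arguments.
Unset Strict Implicit.
Unset Printing Implicit Defensive.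

(** * A register language with bounded cost *)

(** The complexity bound shapes the construction. One machine must serve all n and M, so n may enter
    the running time only through the register bound K, a power of X = (M + 2)(n + 2) with exponent
    linear in n. The program is fixed, hence its length and loop depth are constants. A register is
    kept in unary, as a position on the tape, so that an instruction costs O(K) machine steps and
    the tape needs no arithmetic. The summands 2 keep X at least 6 even when M = 0, so that
    constants can be absorbed into powers of X.

    Windows have length 2n+1 because minimality at j involves the terms from j - n to j + n. In the
    permutation case the period D is only shown to exist and is never computed, so its size is
    irrelevant. What matters is that a single D serves all integer solutions: the translates y + c
    yield a whole family of them, and a period that varied with c need not pass to y. *)

Record store := Store { reg : nat -> nat; arr : nat -> nat -> bool }.

Definition setr s r v := Store (fun x => if x == r then v else reg s x) (arr s).

Definition seta s a i b :=
  Store (reg s) (fun x j => if (x == a) && (j == i) then b else arr s x j).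

Inductive act := Inc of nat | Clr of nat | Put of nat & nat & bool.

Inductive test := Eq of nat & nat | Get of nat & nat.

Inductive prog :=
  | Do of act
  | Seq of prog & prog
  | When of bool & test & prog
  | While of bool & test & prog.

Definition apply (x : act) (s : store) : store :=
  match x with
  | Inc r => setr s r (reg s r).+1
  | Clr r => setr s r 0
  | Put a r b => seta s a (reg s r) b
  end.

Definition eval (t : test) (s : store) : bool :=
  match t with
  | Eq r r' => reg s r == reg s r'
  | Get a r => arr s a (reg s r)
  end.

Definition fits (K : nat) (x : act) (s : store) : bool :=
  if x is Inc r then reg s r < K else true.

Definition bounded (K : nat) (s : store) := forall r, reg s r <= K.

(** Abstract in the relation of the body and recursive on the number of rounds, so that [exec] can
    stay structurally recursive on programs. *)
Fixpoint loops (R : store -> store -> Prop) (b : bool) (t : test) (m : nat)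
    (s s' : store) : Prop :=
  match m with
  | 0 => eval t s = ~~ b /\ s' = s
  | m'.+1 => eval t s = b /\ exists2 s1, R s s1 & loops R b t m' s1 s'
  end.

(* Big-step semantics in which registers may not exceed K and no loop may run
   more than K times, so that the running time is bounded by the shape of the
   program alone (see cost). *)
Fixpoint exec (K : nat) (p : prog) (s s' : store) : Prop :=
  match p with
  | Do x => fits K x s /\ s' = apply x s
  | Seq p q => exists2 s1, exec K p s s1 & exec K q s1 s'
  | When b t p => if eval t s == b then exec K p s s' else s' = s
  | While b t p => exists2 m, m <= K & loops (exec K p) b t m s s'
  end.

Fixpoint cost (K : nat) (p : prog) : nat :=
  match p with
  | Do _ => 1
  | Seq p q => cost K p + cost K q
  | When _ _ p => (cost K p).+1
  | While _ _ p => (K * (cost K p).+1).+1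
  end.

Fixpoint depth (p : prog) : nat :=
  match p with
  | Do _ => 0
  | Seq p q => maxn (depth p) (depth q)
  | When _ _ p => depth p
  | While _ _ p => (depth p).+1
  end.

Fixpoint len (p : prog) : nat :=
  match p with
  | Do _ => 1
  | Seq p q => len p + len q
  | When _ _ p => (len p).+1
  | While _ _ p => (len p).+1
  end.

(** Each nested loop contributes a factor of at most K + 1, so the exponent is the loop depth, a
    constant once the program is fixed. *)
Lemma cost_poly K p : cost K p <= len p * K.+1 ^ depth p.
Proof.
have Kp e : 0 < K.+1 ^ e by rewrite expn_gt0.
elim: p => [x|p IHp q IHq|b t p IHp|b t p IHp] /=.
- by rewrite expn0.
- rewrite mulnDl leq_add //.
  + by apply: leq_trans IHp _; rewrite leq_mul2l leq_pexp2l ?leq_maxl ?orbT.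
  + by apply: leq_trans IHq _; rewrite leq_mul2l leq_pexp2l ?leq_maxr ?orbT.
- by rewrite mulSn -add1n leq_add.
- have /leq_trans -> // : (K * (cost K p).+1).+1 <= K.+1 * (cost K p).+1.
    by rewrite mulSn; lia.
  rewrite expnS mulnCA leq_mul2l /= mulSn -add1n leq_add //.
Qed.

(** * Flat code with explicit successor addresses *)

Inductive instr := IAct of act & nat | ITest of test & nat & nat.

(** [b] is the address of the first instruction and [e] the address where control continues
    afterwards. Every instruction names its successors, so a loop only has to compile its body with
    exit [b], and no jumps are needed. *)
Fixpoint compile (p : prog) (b e : nat) : seq instr :=
  match p with
  | Do x => [:: IAct x e]
  | Seq p q => compile p b (b + len p) ++ compile q (b + len p) e
  | When c t p =>
      ITest t (if c then b.+1 else e) (if c then e else b.+1) :: compile p b.+1 e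
  | While c t p =>
      ITest t (if c then b.+1 else e) (if c then e else b.+1) :: compile p b.+1 b
  end.

Lemma size_compile p b e : size (compile p b e) = len p.
Proof.
elim: p b e => [x|p IHp q IHq|c t p IHp|c t p IHp] b e //=.
- by rewrite size_cat IHp IHq.
- by rewrite IHp.
- by rewrite IHp.
Qed.

Definition next (i : instr) (s : store) : nat * store :=
  match i with
  | IAct x e => (e, apply x s)
  | ITest t e f => (if eval t s then e else f, s)
  end.

Definition ifits (K : nat) (i : instr) (s : store) : bool :=
  if i is IAct x _ then fits K x s else true.

(** The bound on the registers is recorded at every step, because the time to simulate an
    instruction depends on the size of a register. *)
Inductive reach (K : nat) (code : seq instr) : nat -> nat * store -> nat * store -> Prop :=
  | Reach0 c : reach K code 0 c c
  | ReachS m pc s i c : onth code pc = Some i -> bounded K s -> ifits K i s ->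
      reach K code m (next i s) c -> reach K code m.+1 (pc, s) c.

Lemma reach_trans K code m m' c1 c2 c3 :
  reach K code m c1 c2 -> reach K code m' c2 c3 -> reach K code (m + m') c1 c3.
Proof.
move=> H; elim: H => // {}m pc s i c hi hb hf _ IH /IH; exact: ReachS.
Qed.

Lemma bounded_apply K x s : bounded K s -> fits K x s -> bounded K (apply x s).
Proof.
by case: x => [r|r|a r b] //= hb hf x /=; case: eqP => // _; apply: hb.
Qed.

Definition code_at (code : seq instr) (b : nat) (l : seq instr) :=
  exists c1 c2, code = c1 ++ l ++ c2 /\ size c1 = b.

Lemma code_at_cat code b l1 l2 :
  code_at code b (l1 ++ l2) -> code_at code b l1 /\ code_at code (b + size l1) l2.
Proof.
move=> [c1 [c2 [-> <-]]]; split; first by exists c1, (l2 ++ c2); rewrite -!catA.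
by exists (c1 ++ l1), c2; rewrite size_cat -!catA.
Qed.

Lemma code_at_cons code b i l :
  code_at code b (i :: l) -> onth code b = Some i /\ code_at code b.+1 l.
Proof.
move=> H; have [[c1 [c2 [-> <-]]]] := @code_at_cat code b [:: i] l H.
rewrite addn1 => ?; split=> //.
by elim: (c1).
Qed.

Lemma compile_correct K code p b e s s' :
  exec K p s s' -> bounded K s -> code_at code b (compile p b e) ->
  bounded K s' /\ exists2 m, m <= cost K p & reach K code m (b, s) (e, s').
Proof.
elim: p b e s s' => [x|p IHp q IHq|c t p IHp|c t p IHp] b e s s' /=.
- move=> [hf ->] hb /code_at_cons[hi _].
  split; first exact: bounded_apply.
  by exists 1 => //; apply: (ReachS hi) => //; apply: Reach0.
- move=> [s1 h1 h2] hb /code_at_cat[hc1 hc2]; rewrite size_compile in hc2.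
  have [hb1 [m1 hm1 r1]] := IHp _ _ _ _ h1 hb hc1.
  have [hb2 [m2 hm2 r2]] := IHq _ _ _ _ h2 hb1 hc2.
  by split=> //; exists (m1 + m2); [rewrite leq_add | apply: reach_trans r2].
- move=> + hb /code_at_cons[hi hc]; case: eqP => [et|et].
    move=> h1; have [hb1 [m1 hm1 r1]] := IHp _ _ _ _ h1 hb hc.
    split=> //; exists m1.+1 => //; apply: (ReachS hi) => //=.
    by rewrite et; case: (c) r1.
  move=> ->; split=> //; exists 1 => //; apply: (ReachS hi) => //=.
  by have -> : (if eval t s then if c then b.+1 else e else if c then e else b.+1) = e;
    [move: et; case: (eval t s); case: (c) | apply: Reach0].
- move=> [m hm hl] hb /code_at_cons[hi hc].
  (* The exact count is needed for the induction on rounds: one test and one body per round, and one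
     failing test at the end. *)
  suff [hb' [k hk r]] : bounded K s' /\
      exists2 k, k <= (m * (cost K p).+1).+1 & reach K code k (b, s) (e, s').
    split=> //; exists k => //; apply: leq_trans hk _.
    by rewrite ltnS leq_mul2r hm orbT.
  elim: m s {hm} hl hb => [|m IHm] s /=.
    move=> [et ->] hb; split=> //; exists 1 => //; apply: (ReachS hi) => //=.
    by rewrite et; case: (c); apply: Reach0.
  move=> [et [s1 h1 hl]] hb.
  have [hb1 [m1 hm1 r1]] := IHp _ _ _ _ h1 hb hc.
  have [hb2 [m2 hm2 r2]] := IHm _ hl hb1.
  split=> //; exists (m1 + m2).+1; first by rewrite mulSn; lia.
  apply: (ReachS hi) => //=; have -> : (if eval t s then if c then b.+1 else e
    else if c then e else b.+1) = b.+1 by rewrite et; case: (c).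
  exact: reach_trans r2.
Qed.

(** * Compilation to Turing machines *)

(* One instruction is simulated by finding the mark of its key register from
   the origin, acting there, and coming back; Rewind additionally puts the mark
   of a cleared register on the origin, and Turn re-enters cell 0 from -1. *)
Inductive phase := Start | Find | Mark | Back | Rewind | Turn.

Definition phase_code (x : phase) : 'I_6 :=
  inord match x with
        | Start => 0 | Find => 1 | Mark => 2 | Back => 3 | Rewind => 4 | Turn => 5
        end.

Definition phase_decode (i : 'I_6) : phase :=
  nth Start [:: Start; Find; Mark; Back; Rewind; Turn] i.

Lemma phase_codeK : cancel phase_code phase_decode.
Proof. by case; rewrite /phase_decode inordK. Qed.

HB.instance Definition _ := Finite.copy phase (can_type phase_codeK).

(** * The tape alphabet and the tape of a store *)

Section Tracks.

Variable k : nat.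

(* Origin flag, register marks, array bits. *)
Definition sym : Type := (bool * {ffun 'I_k -> bool} * {ffun 'I_k -> bool})%type.

Definition fget (f : {ffun 'I_k -> bool}) (r : nat) : bool :=
  if insub r is Some i then f i else false.

Definition fset (f : {ffun 'I_k -> bool}) (r : nat) (b : bool) : {ffun 'I_k -> bool} :=
  [ffun i : 'I_k => if val i == r then b else f i].

Definition blank_sym : sym := (false, [ffun=> false], [ffun=> false]).

Definition marked (x : sym) (r : nat) := fget x.1.2 r.
Definition bit (x : sym) (a : nat) := fget x.2 a.
Definition wmark (x : sym) (r : nat) (b : bool) : sym := (x.1.1, fset x.1.2 r b, x.2).
Definition wbit (x : sym) (a : nat) (b : bool) : sym := (x.1, fset x.2 a b).

(** A register of value v is the only mark on its track, in cell v. Incrementing it moves the mark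
    by one cell, and two registers are equal when their marks share a cell. *)
Definition symat (s : store) (z : nat) : sym :=
  (z == 0, [ffun r : 'I_k => reg s r == z], [ffun a : 'I_k => arr s a z]).

Lemma marked_symat s z r : r < k -> marked (symat s z) r = (reg s r == z).
Proof. by move=> h; rewrite /marked /fget insubT /= ffunE. Qed.

Lemma bit_symat s z a : a < k -> bit (symat s z) a = arr s a z.
Proof. by move=> h; rewrite /bit /fget insubT /= ffunE. Qed.

Lemma symat_setr s r v z : symat (setr s r v) z = wmark (symat s z) r (v == z).
Proof.
by congr (_, _, _); apply/ffunP=> i; rewrite !ffunE //=; case: (_ == r).
Qed.

Lemma symat_seta s a v b z :
  symat (seta s a v b) z = if z == v then wbit (symat s z) a b else symat s z.
Proof.
case: eqP => [->|/eqP/negbTE h]; congr (_, _, _); apply/ffunP=> i; rewrite !ffunE //=.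
  by rewrite eqxx andbT.
by rewrite h andbF.
Qed.

Lemma wmark_same s r z : wmark (symat s z) r (reg s r == z) = symat s z.
Proof.
by congr (_, _, _); apply/ffunP=> i; rewrite !ffunE //=; case: eqP => [->|].
Qed.

Lemma wmark2 x r b c : wmark (wmark x r b) r c = wmark x r c.
Proof. by congr (_, _, _); apply/ffunP=> i; rewrite !ffunE //=; case: eqP. Qed.

(** Only the nonnegative cells carry data. The cell -1 is entered for a single step at a time, since
    every transition must move the head and so cannot stop on the origin. *)
Definition tape (f : nat -> sym) (z : Z) : sym :=
  if (z <? 0)%Z then blank_sym else f (Z.to_nat z).

Definition upd (f : nat -> sym) p x := fun z => if z == p then x else f z.

Lemma upd_id f p : upd f p (f p) = f.
Proof. by apply: functional_extensionality => z; rewrite /upd; case: eqP => [->|]. Qed.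

End Tracks.

(** Only this mark has to be searched for: the other operand, [track], is read or written in the
    cell where it is found. *)
Definition key (i : instr) : nat :=
  match i with
  | IAct (Inc r) _ | IAct (Clr r) _ | IAct (Put _ r _) _ => r
  | ITest (Eq r _) _ _ | ITest (Get _ r) _ _ => r
  end.

(** The value 0 for tests is a dummy: the phases that consult [exit] are entered from increments and
    clearings only. *)
Definition exit (i : instr) : nat := if i is IAct _ e then e else 0.

Definition track (i : instr) : nat :=
  match i with
  | IAct (Put a _ _) _ => a
  | ITest (Eq _ r) _ _ => r
  | ITest (Get a _) _ _ => a
  | _ => 0
  end.

Definition targets (i : instr) : seq nat :=
  match i with IAct _ e => [:: e] | ITest _ e f => [:: e; f] end.

Section Machine.

Variables (k N : nat) (code : seq instr).

Definition instr_ok (i : instr) : bool :=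
  [&& key i < k, track i < k & all (fun e => e <= N) (targets i)].

Definition peek (t : test) (x : sym k) : bool :=
  match t with Eq _ r => marked x r | Get a _ => bit x a end.

(** Increments and clearings keep the program counter for one more phase, which has to know which
    mark to set again; the others switch to their successor at once. *)
Definition found (pc : nat) (i : instr) (x : sym k) : nat * phase * sym k :=
  match i with
  | IAct (Inc r) _ => (pc, Mark, wmark x r false)
  | IAct (Clr r) _ => (pc, Rewind, wmark x r false)
  | IAct (Put a _ b) e => (e, Back, wbit x a b)
  | ITest t e f => (if peek t x then e else f, Back, x)
  end.

Definition mstate : Type := ('I_N.+1 * phase)%type.

(** Phase [Start] puts the origin flag and all register marks into cell 0, which sets every register
    to 0 and leaves the input bits alone. The machine halts when the program counter points outside
    the code. *)
Definition mdelta (q : mstate) (x : sym k) : option (mstate * sym k * bool) :=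
  match q.2 with
  | Start => Some ((ord0, Turn), (true, [ffun=> true], x.2), false)
  | Back => Some ((q.1, if x.1.1 then Turn else Back), x, false)
  | Turn => Some ((q.1, Find), x, true)
  | Find =>
      if onth code q.1 is Some i then
        if marked x (key i) then
          let: (pc, ph, y) := found q.1 i x in Some ((inord pc, ph), y, true)
        else Some (q, x, true)
      else None
  | Mark =>
      if onth code q.1 is Some i then
        Some ((inord (exit i), Back), wmark x (key i) true, true)
      else None
  | Rewind =>
      if onth code q.1 is Some i then
        if x.1.1 then Some ((inord (exit i), Turn), wmark x (key i) true, false)
        else Some (q, x, false)
      else None
  end.

(** The input bit false is the same symbol as the blank. This loses nothing, because the encoding is
    self-delimiting, and it matches the default value in [nth false]. *)
Definition machine (accepting : nat) (input : nat) : TM :=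
  @MkTM mstate (sym k) (blank_sym k)
    (fun b => wbit (blank_sym k) input b) (ord0, Start) mdelta
    (fun q => val q.1 == accepting).

Variables accepting input : nat.
Let m := machine accepting input.

Fixpoint steps (j : nat) (c : config m) : option (config m) :=
  if j is j'.+1 then obind (steps j') (step c) else Some c.

Lemma stepsS j c : steps j.+1 c = obind (steps j) (step c).
Proof. by []. Qed.

Lemma steps_add i j c c' : steps i c = Some c' -> steps (i + j) c = steps j c'.
Proof. by elim: i c => [|i IH] c /=; [move=> [->] | case: (step c)]. Qed.

Lemma run_steps j f c c' : steps j c = Some c' -> run (j + f) c = run f c'.
Proof. by elim: j c => [|j IH] c /=; [move=> [->] | case: (step c)]. Qed.

Lemma run_halt f (c : config m) : step c = None -> run f c = Some c.
Proof. by case: f => [|f] /= ->. Qed.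

Definition conf (pc : nat) (ph : phase) (f : nat -> sym k) (p : Z) : config m :=
  ((inord pc, ph), tape f, p).

Lemma step_conf pc ph pc' ph' x d f p :
  mdelta (inord pc, ph) (f p) = Some ((inord pc', ph'), x, d) ->
  step (conf pc ph f (Z.of_nat p))
  = Some (conf pc' ph' (upd f p x) (if d then Z.of_nat p.+1 else Z.of_nat p - 1)%Z).
Proof.
move=> h; rewrite /step /conf.
have -> : tape f (Z.of_nat p) = f p.
  rewrite /tape (_ : (_ <? _)%Z = false) ?Nat2Z.id //; lia.
change (tm_delta (t := m)) with mdelta; rewrite h; congr (Some (_, _, _)).
  apply: functional_extensionality => z; rewrite /tape /upd.
  case: Z.eqb_spec => [->|hz].
    by rewrite (_ : (_ <? _)%Z = false) ?Nat2Z.id ?eqxx //; lia.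
  case: Z.ltb_spec => // hz0; case: eqP => // e; lia.
by case: d {h} => //; lia.
Qed.

Lemma step_right pc ph pc' ph' x f p :
  mdelta (inord pc, ph) (f p) = Some ((inord pc', ph'), x, true) ->
  step (conf pc ph f (Z.of_nat p)) = Some (conf pc' ph' (upd f p x) (Z.of_nat p.+1)).
Proof. exact: step_conf. Qed.

Lemma step_left pc ph pc' ph' x f p :
  mdelta (inord pc, ph) (f p.+1) = Some ((inord pc', ph'), x, false) ->
  step (conf pc ph f (Z.of_nat p.+1)) = Some (conf pc' ph' (upd f p.+1 x) (Z.of_nat p)).
Proof. by move/step_conf ->; congr (Some (conf _ _ _ _)); lia. Qed.

Lemma step_left0 pc ph pc' ph' x f :
  mdelta (inord pc, ph) (f 0) = Some ((inord pc', ph'), x, false) ->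
  step (conf pc ph f (Z.of_nat 0)) = Some (conf pc' ph' (upd f 0 x) (-1)).
Proof. by move/step_conf ->. Qed.

Lemma steps_turn pc f : steps 1 (conf pc Turn f (-1)) = Some (conf pc Find f 0).
Proof.
rewrite stepsS /step /=; congr (Some (_, _, _)).
by apply: functional_extensionality => z; case: Z.eqb_spec => // ->.
Qed.

Definition origin_ok (f : nat -> sym k) := forall z, (f z).1.1 = (z == 0).

(** p + 1 moves to the left lead to the cell -1, and one more re-enters cell 0. *)
Lemma steps_back pc f p : origin_ok f ->
  steps (p + 2) (conf pc Back f (Z.of_nat p)) = Some (conf pc Find f 0).
Proof.
move=> hf; elim: p => [|p IH].
  rewrite addn2 stepsS (@step_left0 _ _ pc Turn (f 0)); last by rewrite /mdelta /= hf.
  by rewrite upd_id; exact: steps_turn.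
rewrite addSn stepsS (@step_left _ _ pc Back (f p.+1)); first by rewrite upd_id.
by rewrite /mdelta /= hf.
Qed.

Lemma steps_find pc i f p d : pc <= N -> onth code pc = Some i ->
  (forall z, p <= z < p + d -> marked (f z) (key i) = false) ->
  steps d (conf pc Find f (Z.of_nat p)) = Some (conf pc Find f (Z.of_nat (p + d))).
Proof.
move=> hpc hi; elim: d p => [|d IH] p hz; first by rewrite addn0.
rewrite stepsS (@step_right _ _ pc Find (f p)).
  rewrite upd_id addnS -addSn; apply: IH => z hz'; apply: hz; lia.
rewrite /mdelta /= inordK // hi hz //; lia.
Qed.

Lemma steps_rewind pc i f p : pc <= N -> onth code pc = Some i -> origin_ok f ->
  steps (p + 2) (conf pc Rewind f (Z.of_nat p))
  = Some (conf (exit i) Find (upd f 0 (wmark (f 0) (key i) true)) 0).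
Proof.
move=> hpc hi hf; elim: p => [|p IH].
  rewrite addn2 stepsS (@step_left0 _ _ (exit i) Turn (wmark (f 0) (key i) true)).
    exact: steps_turn.
  by rewrite /mdelta /= inordK // hi hf.
rewrite addSn stepsS (@step_left _ _ pc Rewind (f p.+1)); first by rewrite upd_id.
by rewrite /mdelta /= inordK // hi hf.
Qed.

(** Increment is the worst case: v + 1 steps to reach and erase the mark in cell v, one to set it in
    the next cell, v + 4 to return. *)
Lemma steps_instr pc i s : pc <= N -> onth code pc = Some i -> instr_ok i ->
  exists2 j, j <= 2 * reg s (key i) + 6 &
    steps j (conf pc Find (symat k s) 0)
    = Some (conf (next i s).1 Find (symat k (next i s).2) 0).
Proof.
move=> hpc hi /and3P[hk ht hN]; move hv: (reg s (key i)) => v.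
have find : steps v (conf pc Find (symat k s) (Z.of_nat 0))
    = Some (conf pc Find (symat k s) (Z.of_nat v)).
  apply: steps_find hi _ => // z hz; rewrite marked_symat //.
  by apply/negbTE/eqP; lia.
have hit q ph y : found pc i (symat k s v) = (q, ph, y) ->
    steps (v + 1) (conf pc Find (symat k s) 0)
    = Some (conf q ph (upd (symat k s) v y) (Z.of_nat v.+1)).
  move=> e; rewrite (steps_add _ find) stepsS (@step_right _ _ q ph y) //.
  by rewrite /mdelta /= inordK // hi marked_symat // hv eqxx e.
case: i hi hk ht hN hv find hit =>
  [[r|r|a r b] e|t e f] hi hk ht hN hv find hit; rewrite /= in hk ht hN hv *.
- have hit1 := hit _ _ _ erefl.
  pose g := upd (symat k s) v (wmark (symat k s v) r false).
  have hit2 : steps 1 (conf pc Mark g (Z.of_nat v.+1)) =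
      Some (conf e Back (upd g v.+1 (wmark (g v.+1) r true)) (Z.of_nat v.+2)).
    rewrite stepsS (@step_right _ _ e Back (wmark (g v.+1) r true)) //.
    by rewrite /mdelta /= inordK // hi.
  exists ((v + 1) + (1 + (v.+2 + 2))); first by lia.
  rewrite (steps_add _ hit1) (steps_add _ hit2) steps_back.
    congr (Some (conf _ _ _ _)); apply: functional_extensionality => z.
    rewrite symat_setr /upd /g /upd; have [->|hz] := eqVneq z v.+1.
      by rewrite hv eqxx (gtn_eqF (ltnSn v)).
    have [->|hz'] := eqVneq z v; first by rewrite hv (gtn_eqF (ltnSn v)).
    rewrite hv [v.+1 == z]eq_sym (negbTE hz) -{1}(wmark_same k s r) hv.
    by rewrite [v == z]eq_sym (negbTE hz').
  by move=> z; rewrite /g /upd; do 2?[case: ifP => [/eqP -> //|_]].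
- have hit1 := hit _ _ _ erefl.
  pose g := upd (symat k s) v (wmark (symat k s v) r false).
  have hit2 := @steps_rewind pc _ g v.+1 hpc hi.
  exists ((v + 1) + (v.+1 + 2)); first by lia.
  rewrite (steps_add _ hit1) hit2 /=; last first.
    by move=> z; rewrite /g /upd; case: ifP => // /eqP ->.
  congr (Some (conf _ _ _ _)); apply: functional_extensionality => z.
  rewrite symat_setr /upd /g /upd; have [->|hz] := eqVneq z 0.
    (* If the register was already 0, the erased and the new mark lie in the same cell. *)
    by case: eqP => // e0; rewrite wmark2 -e0.
  have [->//|hz'] := eqVneq z v.
  by rewrite -{1}(wmark_same k s r) hv [v == z]eq_sym (negbTE hz').
- have hit1 := hit _ _ _ erefl.
  exists ((v + 1) + (v.+1 + 2)); first by lia.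
  rewrite (steps_add _ hit1) steps_back.
    congr (Some (conf _ _ _ _)); apply: functional_extensionality => z.
    by rewrite symat_seta hv /upd; case: eqP => // ->.
  by move=> z; rewrite /upd; case: ifP => // /eqP ->.
- have hit1 := hit _ _ _ erefl.
  exists ((v + 1) + (v.+1 + 2)); first by lia.
  rewrite (steps_add _ hit1) upd_id steps_back //; congr (Some (conf (if _ then _ else _) _ _ _)).
  case: t {hi find hit hit1} hk ht hN hv => [r r'|a r] /= hk ht hN hv.
    by rewrite marked_symat // hv eq_sym.
  by rewrite bit_symat // hv.
Qed.

Lemma all_onth (P : pred instr) l pc i : all P l -> onth l pc = Some i -> P i.
Proof.
elim: l pc => [|x l IH] [|pc] //= /andP[hx hl]; first by case=> <-.
exact: IH.
Qed.

Lemma steps_reach K n c c' :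
  all instr_ok code -> c.1 <= N -> reach K code n c c' ->
  exists2 j, j <= n * (2 * K + 6) &
    steps j (conf c.1 Find (symat k c.2) 0) = Some (conf c'.1 Find (symat k c'.2) 0).
Proof.
move=> hok + h; elim: h => {n c c'} [c|n pc s i c hi hb hf _ IH] /= hpc.
  by exists 0.
have oki := all_onth hok hi.
have [j hj hs] := steps_instr s hpc hi oki.
have hn : (next i s).1 <= N.
  case/and3P: oki => _ _; case: i {hi hf IH hs hj} => [x e|t e f] /=; first by case/andP.
  by rewrite andbT => /andP[]; case: ifP.
have [j' hj' hs'] := IH hn.
exists (j + j'); last by rewrite (steps_add _ hs).
by rewrite mulSn leq_add // (leq_trans hj) // leq_add2r leq_mul2l hb.
Qed.

(* The input bits are read through the array number [input]. *)
Lemma steps_start w : 0 < k -> input < k ->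
  steps 2 (init m w) = Some (conf 0 Find
    (symat k (Store (fun=> 0) (fun a z => (a == input) && nth false w z))) 0).
Proof.
move=> k0 hin; set s := Store _ _.
pose f z := wbit (blank_sym k) input (nth false w z).
have -> : init m w = conf 0 Start f (Z.of_nat 0).
  congr (_, _, _); first by congr (_, _); apply/val_inj; rewrite /= inordK.
  apply: functional_extensionality => z; rewrite /tape /f.
  case: Z.leb_spec => hz /=; last by rewrite (_ : (z <? 0)%Z = true) //; lia.
  rewrite (_ : (z <? 0)%Z = false); last lia.
  case: Z.ltb_spec => // h; rewrite nth_default; last lia.
  by congr (_, _); apply/ffunP=> i; rewrite !ffunE; case: ifP.
rewrite stepsS (@step_left0 _ _ 0 Turn (true, [ffun=> true], (f 0).2)).
  apply: etrans (steps_turn 0 _) _; congr (Some (conf _ _ _ _)).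
  apply: functional_extensionality => z; rewrite /upd /f.
  case: eqP => [->|/eqP/negbTE hz]; congr (_, _, _); rewrite /= ?hz //;
    apply/ffunP=> i; rewrite !ffunE //= 1?eq_sym ?hz //; by case: (_ == input).
by rewrite /mdelta /=; congr (Some (_, _, _, _)); apply/val_inj; rewrite /= inordK.
Qed.

End Machine.

(** * Turing machines for whole programs *)

Definition act_ok (k : nat) (x : act) : bool :=
  match x with Inc r | Clr r => r < k | Put a r _ => (a < k) && (r < k) end.

Definition test_ok (k : nat) (t : test) : bool :=
  match t with Eq x y | Get x y => (x < k) && (y < k) end.

Fixpoint prog_ok (k : nat) (p : prog) : bool :=
  match p with
  | Do x => act_ok k x
  | Seq p q => prog_ok k p && prog_ok k q
  | When _ t p | While _ t p => test_ok k t && prog_ok k p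
  end.

Lemma compile_ok k N p b e : 0 < k -> prog_ok k p -> b + len p <= N -> e <= N ->
  all (instr_ok k N) (compile p b e).
Proof.
move=> k0; have tok t x y : test_ok k t -> x <= N -> y <= N -> instr_ok k N (ITest t x y).
  by case: t => u v /= /andP[hu hv] hx hy; rewrite /instr_ok /= hu hv hx hy.
elim: p b e => [x|p IHp q IHq|c t p IHp|c t p IHp] b e /=.
- move=> + _ he; case: x => [r|r|a r v] /=; rewrite /instr_ok /= he ?k0 ?andbT //.
  by rewrite andbC => ->.
- case/andP=> hp hq hb he; rewrite all_cat IHp ?IHq //; lia.
- case/andP=> ht hp hb he; rewrite IHp ?andbT //; last lia.
  by apply: tok => //; case: (c); lia.
- case/andP=> ht hp hb he; rewrite IHp ?andbT //; try lia.
  by apply: tok => //; case: (c); lia.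
Qed.

Definition input_store (input : nat) (w : seq bool) : store :=
  Store (fun=> 0) (fun a z => (a == input) && nth false w z).

(* Acceptance means that the registers [x] and [y] end up different. *)
Definition prog_code (p : prog) (x y : nat) : seq instr :=
  compile p 0 (len p) ++ [:: ITest (Eq x y) (len p).+2 (len p).+1].

(** The last instruction has address [len p], so both targets of the final test lie outside the code
    and the machine halts on arrival. *)
Definition prog_machine (k : nat) (p : prog) (x y input : nat) : TM :=
  machine k (len p).+2 (prog_code p x y) (len p).+1 input.

Lemma prog_machine_correct k p x y input K w s :
  x < k -> y < k -> input < k -> prog_ok k p ->
  exec K p (input_store input w) s ->
  forall fuel, 2 + (cost K p).+1 * (2 * K + 6) <= fuel ->
  exists h : config (prog_machine k p x y input),
    run fuel (init _ w) = Some h /\ (@tm_accept _ (cstate h) <-> reg s x <> reg s y).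
Proof.
move=> hx hy hin hp he fuel hfuel.
have k0 : 0 < k by lia.
pose code := prog_code p x y; pose N := (len p).+2.
have hok : all (instr_ok k N) code.
  rewrite all_cat compile_ok //; try lia.
  by rewrite /= /instr_ok /= hx hy !leqnn leqnSn.
have hb : bounded K (input_store input w) by move=> r.
have hat : code_at code 0 (compile p 0 (len p)).
  by exists [::]; eexists; split; first reflexivity.
have [hb' [n hn r1]] := compile_correct he hb hat.
have hi : onth code (len p) = Some (ITest (Eq x y) (len p).+2 (len p).+1).
  by rewrite onth_cat size_compile ltnn subnn.
have r2 : reach K code 1 (len p, s) (next (ITest (Eq x y) (len p).+2 (len p).+1) s).
  by apply: (ReachS hi) => //; apply: Reach0.
have r := reach_trans r1 r2.
have [//|j hj hs] := @steps_reach k N code (len p).+1 input K _ _ _ hok _ r.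
have hs0 := @steps_start k N code (len p).+1 input w k0 hin.
have {hs0}hs : steps (2 + j) (init (prog_machine k p x y input) w) = _ :=
  etrans (steps_add _ hs0) hs.
have hj' : 2 + j <= fuel.
  apply: leq_trans hfuel; rewrite leq_add2l; apply: leq_trans hj _.
  by rewrite leq_mul2r addn1 ltnS hn orbT.
eexists; split.
  rewrite -(subnKC hj') (run_steps _ hs); apply: run_halt.
  rewrite /step /conf /= /mdelta /=.
  have -> : onth code (@inord N (if reg s x == reg s y then N else (len p).+1)) = None.
    apply: onth_default; rewrite size_cat size_compile addn1 inordK.
      by case: ifP.
    by case: ifP.
  by [].
rewrite /cstate /= inordK; last by case: ifP.
by case: (reg s x =P reg s y) => h; split=> //; rewrite ?eqxx // gtn_eqF.
Qed.

(** * The graph of windows *)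

Definition dig (B u i : nat) : nat := u %/ B ^ i %% B.

Fixpoint enc (B : nat) (f : nat -> nat) (l : nat) : nat :=
  if l is l'.+1 then f 0 + B * enc B (fun i => f i.+1) l' else 0.

Lemma dig0 B u : dig B u 0 = u %% B.
Proof. by rewrite /dig expn0 divn1. Qed.

Lemma digS B u i : dig B u i.+1 = dig B (u %/ B) i.
Proof. by rewrite /dig expnS divnMA. Qed.

Lemma dig_mod B w i l : i < l -> dig B (w %% B ^ l) i = dig B w i.
Proof.
move=> il; rewrite /dig !modn_divl -expnS; congr (_ %/ _).
by rewrite modn_dvdm // dvdn_exp2l.
Qed.

Lemma eq_enc B f g l : (forall i, i < l -> f i = g i) -> enc B f l = enc B g l.
Proof.
elim: l f g => [|l IH] f g h //=; rewrite h // (IH _ (fun i => g i.+1)) //.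
by move=> i il; apply: h.
Qed.

Lemma enc_dig B u l : u < B ^ l -> enc B (dig B u) l = u.
Proof.
elim: l u => [|l IH] u; first by rewrite expn0; case: u.
case: (posnP B) => [->|B0]; first by rewrite exp0n.
rewrite expnS mulnC -ltn_divLR // => h.
rewrite /= dig0 (@eq_enc _ _ (dig B (u %/ B))) => [|i _]; last by rewrite digS.
by rewrite IH // addnC mulnC -divn_eq.
Qed.

Section Base.

Variable B : nat.
Hypothesis B0 : 0 < B.

Lemma enc_lt f l : (forall i, f i < B) -> enc B f l < B ^ l.
Proof.
elim: l f => [|l IH] f h; first by rewrite expn0.
rewrite /= expnS; have := IH (fun i => f i.+1) (fun i => h i.+1); have := h 0.
set e := enc _ _ _; move=> h0 he.
have : B * e.+1 <= B * B ^ l by rewrite leq_mul2l he orbT.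
rewrite mulnS; lia.
Qed.

Lemma enc_div f l : (forall i, f i < B) -> enc B f l.+1 %/ B = enc B (fun i => f i.+1) l.
Proof. by move=> h /=; rewrite addnC mulnC divnMDl // divn_small ?addn0. Qed.

Lemma enc_modB f l : (forall i, f i < B) -> enc B f l.+1 %% B = f 0.
Proof. by move=> h /=; rewrite addnC mulnC modnMDl modn_small. Qed.

Lemma enc_last f l : enc B f l.+1 = enc B f l + B ^ l * f l.
Proof.
elim: l f => [|l IH] f; first by rewrite /= expn0; lia.
by rewrite -[LHS]/(f 0 + B * enc B (fun i => f i.+1) l.+1) IH /= mulnDr addnA expnS mulnA.
Qed.

Lemma enc_mod f l : (forall i, f i < B) -> enc B f l.+1 %% B ^ l = enc B f l.
Proof. by move=> h; rewrite enc_last addnC mulnC modnMDl modn_small // enc_lt. Qed.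

Lemma dig_enc f l i : (forall i, f i < B) -> i < l -> dig B (enc B f l) i = f i.
Proof.
elim: l f i => [//|l IH] f [|i] h il; first by rewrite dig0 enc_modB.
by rewrite digS enc_div // IH.
Qed.

End Base.

Section Graph.

Variables (n B : nat) (na : nat -> nat).

Definition att (d : nat -> nat) (i k : nat) : bool :=
  all (fun l => na i + d (i + k) <= na l + d (l + k)) (iota 0 n.+1).

(* The base-B digits of u are the letters of a window of length 2n+1: the minimum
   is attained twice at its start, and its central letter attains some minimum. *)
Definition admissible (u : nat) : bool :=
  (1 < count (fun i => att (dig B u) i 0) (iota 0 n.+1)) &&
  has (fun i => att (dig B u) i (n - i)) (iota 0 n.+1).

Definition nwords := B ^ n.*2.+1.
Let N := nwords.

(* A word w of length 2n+2 is an edge from its prefix w %% N to its suffix w %/ B. *)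
Definition edge (X : nat -> bool) (w : nat) : bool := X (w %/ B) && X (w %% N).

(** The bound m lets the same predicate describe the partial result of a loop over the edges, and
    lets [merging] ask for an earlier edge. *)
Definition has_in (X : nat -> bool) (u m : nat) : bool :=
  has (fun w => (w %/ B == u) && edge X w) (iota 0 m).

Definition has_out (X : nat -> bool) (u m : nat) : bool :=
  has (fun w => (w %% N == u) && edge X w) (iota 0 m).

Definition trim (X : nat -> bool) (u : nat) : bool :=
  [&& X u, has_in X u (B * N) & has_out X u (B * N)].

Definition alive : nat -> bool := iter N trim admissible.

(** Two different edges with the same quotient by B differ in their lowest digit, so they come from
    different predecessors. Asking for the second edge below w makes one pass over the edges enough
    to find such a pair. *)
Definition merging (X : nat -> bool) (m : nat) : bool :=
  has (fun w => edge X w && has_in X (w %/ B) w) (iota 0 m).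

Hypothesis B0 : 0 < B.

Lemma N_gt0 : 0 < N. Proof. by rewrite expn_gt0 B0. Qed.

Lemma divB_lt w : w < B * N -> w %/ B < N.
Proof. by move=> h; rewrite ltn_divLR // mulnC. Qed.

Lemma modN_lt w : w %% N < N. Proof. by rewrite ltn_mod N_gt0. Qed.

Lemma has_iotaP (P : pred nat) m : reflect (exists2 i, i < m & P i) (has P (iota 0 m)).
Proof.
apply: (iffP hasP) => -[i]; first by rewrite mem_iota => ? ?; exists i.
by move=> hi hP; exists i => //; rewrite mem_iota.
Qed.

Lemma eq_trim X Y : (forall u, u < N -> X u = Y u) -> forall u, u < N -> trim X u = trim Y u.
Proof.
move=> h u hu; rewrite /trim h //; congr [&& _, _ & _]; apply: eq_in_has => w;
  by rewrite mem_iota /= add0n /edge => hw; rewrite !h ?modN_lt ?divB_lt.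
Qed.

(** A round that changes nothing is followed only by such rounds, and any other round removes at
    least one vertex. *)
Lemma trim_stable X t :
  (forall u, u < N -> iter t.+1 trim X u = iter t trim X u) \/
  #|[set u : 'I_N | iter t trim X u]| + t <= N.
Proof.
elim: t => [|t [IH|IH]]; first by right; rewrite addn0 -[leqRHS]card_ord max_card.
  by left=> u hu; apply: eq_trim.
set S := [set u : 'I_N | iter t trim X u] in IH.
set S' := [set u : 'I_N | iter t.+1 trim X u].
have sub : S' \subset S by apply/subsetP=> u; rewrite !inE /= => /and3P[].
case: (boolP (S \subset S')) => [sub'|nsub]; last first.
  right; apply: leq_trans IH; rewrite addnS -addSn leq_add2r.
  by apply: proper_card; rewrite properE sub.
left; apply: eq_trim => u hu.
have /eqP e : S' == S by rewrite eqEsubset sub sub'.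
by move/setP: e => /(_ (Ordinal hu)); rewrite !inE.
Qed.

Lemma alive_trim u : u < N -> alive u -> trim alive u.
Proof.
move=> hu; case: (trim_stable admissible N) => [h|h].
  by rewrite -[trim alive u]/(iter N.+1 trim admissible u) h.
(* N strict rounds leave no vertex at all, which contradicts that u is alive. *)
have : [set u : 'I_N | alive u] == set0 by rewrite -cards_eq0 -leqn0 -(leq_add2r N) add0n.
by move/eqP/setP => /(_ (Ordinal hu)); rewrite !inE => ->.
Qed.

Lemma alive_admissible u : alive u -> admissible u.
Proof. by rewrite /alive; elim: N => //= t IH /and3P[/IH]. Qed.

(* The window of [y] at [j], read as a number with its first letter as the
   lowest digit. *)
Definition window (y : Z -> nat) (j : Z) (l : nat) : nat :=
  enc B (fun i => y (j + Z.of_nat i)%Z) l.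

Definition bounded_seq (y : Z -> nat) := forall j, y j < B.
Definition admissible_seq (y : Z -> nat) := forall j, admissible (window y j n.*2.+1).

Lemma window_edge y j : bounded_seq y ->
  [/\ window y j n.*2.+2 < B * N,
      window y j n.*2.+2 %/ B = window y (j + 1) n.*2.+1 &
      window y j n.*2.+2 %% N = window y j n.*2.+1].
Proof.
move=> hy; split.
- by have := @enc_lt _ B0 (fun i => y (j + Z.of_nat i)%Z) n.*2.+2 (fun i => hy _); rewrite expnS.
- rewrite /window enc_div //; apply: eq_enc => i _; congr y; lia.
- by rewrite /window enc_mod.
Qed.

Lemma window_lt y j : bounded_seq y -> window y j n.*2.+1 < N.
Proof. by move=> hy; apply: enc_lt. Qed.

(** The preceding and following windows of the same sequence support this one in every round. *)
Lemma window_alive y j : bounded_seq y -> admissible_seq y -> alive (window y j n.*2.+1).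
Proof.
move=> hy hok; rewrite /alive; elim: N j => [|t IH] j; first exact: hok.
rewrite iterS /trim IH /=; apply/andP; split; apply/has_iotaP.
  have [h1 h2 h3] := window_edge (j - 1) hy.
  have e : (j - 1 + 1)%Z = j by lia.
  by exists (window y (j - 1) n.*2.+2) => //; rewrite /edge h2 h3 e eqxx !IH.
have [h1 h2 h3] := window_edge j hy.
by exists (window y j n.*2.+2) => //; rewrite /edge h2 h3 eqxx !IH.
Qed.

Lemma not_merging_eq w w' : ~~ merging alive (B * N) ->
  w < B * N -> w' < B * N -> edge alive w -> edge alive w' -> w %/ B = w' %/ B -> w = w'.
Proof.
move=> hm; wlog hlt : w w' / w < w' => [H hw hw' he he' e|hw hw' he he' e].
  by case: (ltngtP w w') => // h; [apply: H | symmetry; apply: H].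
case/negP: hm; apply/has_iotaP; exists w' => //; rewrite he' /=.
by apply/has_iotaP; exists w => //; rewrite he e eqxx.
Qed.

(* Without merging, "predecessor" is a surjection of the alive vertices, hence
   a permutation, and one period serves all sequences. *)
Lemma not_merging_period : ~~ merging alive (B * N) ->
  exists2 D : nat, 0 < D & forall y, bounded_seq y -> admissible_seq y ->
    forall j, y (j + Z.of_nat D)%Z = y j.
Proof.
move=> hm.
pose inw (u : nat) (w : 'I_(B * N)) := (w %/ B == u) && edge alive w.
(* On an alive vertex the chosen edge is the only alive edge ending there. Elsewhere [g] is the
   identity, which makes it a self-map of the whole finite set. *)
pose g (u : 'I_N) : 'I_N :=
  if [pick w | inw u w] is Some w then Ordinal (modN_lt w) else u.
have gE (w : 'I_(B * N)) (u : 'I_N) : inw u w -> val (g u) = w %% N.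
  rewrite /g; case: pickP => [w' /andP[/eqP h1 h2]|/(_ w) -> //] /andP[/eqP h3 h4] /=.
  by rewrite (not_merging_eq hm _ _ h2 h4) // h1.
have g_surj (u : 'I_N) : exists v, g v == u.
  case: (boolP (alive u)) => hu.
    have /and3P[_ _ /has_iotaP[w hw /andP[/eqP h1 h2]]] := alive_trim (ltn_ord u) hu.
    exists (Ordinal (divB_lt hw)); apply/eqP/val_inj.
    by rewrite (gE (Ordinal hw)) // /inw /= eqxx.
  exists u; rewrite /g; case: pickP => // w /andP[/eqP h1 /andP[h2 _]].
  by rewrite -h1 h2 in hu.
(* A right inverse of [g] is injective, hence bijective on a finite set; along an admissible
   sequence it is the passage to the next window. *)
pose h u := xchoose (g_surj u).
have hK : cancel h g by move=> u; apply/eqP/(xchooseP (g_surj u)).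
have h_inj := can_inj hK.
have gK : cancel g h by apply/bij_can_sym => //; apply: injF_bij.
(* The order of each vertex under [h] is at most N and so divides N!. *)
exists N`!; first exact: fact_gt0.
move=> y hy hok j.
pose x j := Ordinal (window_lt j hy).
have hx i : x (i + 1)%Z = h (x i).
  rewrite -[LHS]gK; congr h; apply/val_inj => /=.
  have [h1 h2 h3] := window_edge i hy.
  rewrite (gE (Ordinal h1)) /= ?h3 // /inw /edge /= h2 h3 eqxx /=.
  by rewrite !window_alive.
have hxm m i : x (i + Z.of_nat m)%Z = iter m h (x i).
  elim: m => [|m IH]; first by rewrite Z.add_0_r.
  by rewrite iterS -IH -hx; congr x; lia.
have hper : iter N`! h (x j) = x j.
  have /dvdnP[c ->] : order h (x j) %| N`!.
    apply: dvdn_fact; rewrite order_gt0 /=.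
    by rewrite -[leqRHS]card_ord; apply: max_card.
  by elim: c => [//|c IH]; rewrite mulSn iterD IH iter_order.
have /(congr1 val) /= e := hxm N`! j; rewrite hper /= in e.
have h0 i : y i = window y i n.*2.+1 %% B.
  by rewrite /window enc_modB // Z.add_0_r.
by rewrite h0 e -h0.
Qed.

(** * Bi-infinite paths through a given edge *)

Definition linked (u v : nat) : Prop :=
  exists w, [/\ w < B * N, w %% N = u, w %/ B = v & edge alive w].

Lemma linked_dig u v i : i < n.*2 -> linked u v -> dig B u i.+1 = dig B v i.
Proof. by move=> hi [w [_ <- <- _]]; rewrite dig_mod // digS. Qed.

Definition letters (x : Z -> nat) (j : Z) : nat := x j %% B.

(** Consecutive vertices overlap in 2n letters, so the first letter of the vertex i places ahead is
    digit i of the present one. *)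
Lemma window_letters x : (forall j, linked (x j) (x (j + 1)%Z)) ->
  forall j, window (letters x) j n.*2.+1 = x j.
Proof.
move=> hx j.
have [w [hw h1 _ _]] := hx j.
rewrite -[RHS](@enc_dig B _ n.*2.+1); last by rewrite -h1 modN_lt.
apply: eq_enc => i; rewrite /letters -dig0; elim: i j {w hw h1} => [|i IH] j hi.
  by rewrite Z.add_0_r.
rewrite (linked_dig _ (hx j)) // -IH ?(ltnW hi) //; congr (dig _ (x _) _); lia.
Qed.

Definition next_vertex (u : nat) : nat :=
  if [pick w : 'I_(B * N) | (w %% N == u) && edge alive w] is Some w then w %/ B else u.

Definition prev_vertex (u : nat) : nat :=
  if [pick w : 'I_(B * N) | (w %/ B == u) && edge alive w] is Some w then w %% N else u.

Lemma linked_next u : u < N -> alive u -> linked u (next_vertex u).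
Proof.
move=> hu /(alive_trim hu) /and3P[_ _ /has_iotaP[w hw h]].
rewrite /next_vertex; case: pickP => [w' /andP[/eqP h1 h2]|/(_ (Ordinal hw))]; last by rewrite h.
by exists w'.
Qed.

Lemma linked_prev u : u < N -> alive u -> linked (prev_vertex u) u.
Proof.
move=> hu /(alive_trim hu) /and3P[_ /has_iotaP[w hw h] _].
rewrite /prev_vertex; case: pickP => [w' /andP[/eqP h1 h2]|/(_ (Ordinal hw))]; last by rewrite h.
by exists w'.
Qed.

Lemma linked_alive u v : linked u v -> [/\ u < N, alive u, v < N & alive v].
Proof. by move=> [w [hw <- <- /andP[h1 h2]]]; rewrite modN_lt divB_lt. Qed.

(** The vertex q stands at -1 and p at 0. The half from 0 on depends on p alone, so two predecessors
    of p give paths with a common right half. *)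
Definition path_through (q p : nat) (j : Z) : nat :=
  if (0 <=? j)%Z then iter (Z.to_nat j) next_vertex p
  else iter (Z.to_nat (-1 - j)) prev_vertex q.

Lemma linked_path q p : linked q p ->
  forall j, linked (path_through q p j) (path_through q p (j + 1)).
Proof.
move=> hl; have [hq aq hp ap] := linked_alive hl.
have hnext m : linked (iter m next_vertex p) (iter m.+1 next_vertex p).
  elim: m => [|m IH]; first exact: linked_next.
  by have [_ _ h1 h2] := linked_alive IH; apply: linked_next.
have hprev m : linked (iter m.+1 prev_vertex q) (iter m prev_vertex q).
  elim: m => [|m IH]; first exact: linked_prev.
  by have [h1 h2 _ _] := linked_alive IH; apply: linked_prev.
move=> j; rewrite /path_through; case: Z.leb_spec => hj.
  have -> : (0 <=? j + 1)%Z = true by lia.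
  by have -> : Z.to_nat (j + 1) = (Z.to_nat j).+1 by lia.
case: Z.leb_spec => hj'; first by have -> : j = (-1)%Z by lia.
by have -> : Z.to_nat (-1 - j) = (Z.to_nat (-1 - (j + 1))).+1 by lia.
Qed.

Lemma merging_not_periodic : merging alive (B * N) ->
  exists y : Z -> nat, [/\ bounded_seq y, admissible_seq y &
    ~ exists d, (1 <= d)%Z /\ forall j, y (j + d)%Z = y j].
Proof.
case/has_iotaP=> w hw /andP[ew /has_iotaP[w' hw' /andP[/eqP e ew']]].
set p := w %/ B in e.
have l1 : linked (w %% N) p by exists w.
have l2 : linked (w' %% N) p by exists w'; split=> //; apply: ltn_trans hw.
pose y1 := letters (path_through (w %% N) p).
pose y2 := letters (path_through (w' %% N) p).
have b1 : bounded_seq y1 by move=> j; rewrite ltn_mod.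
have b2 : bounded_seq y2 by move=> j; rewrite ltn_mod.
have a1 : admissible_seq y1.
  move=> j; rewrite window_letters; last exact: linked_path.
  by have [_ /alive_admissible] := linked_alive (linked_path l1 j).
have a2 : admissible_seq y2.
  move=> j; rewrite window_letters; last exact: linked_path.
  by have [_ /alive_admissible] := linked_alive (linked_path l2 j).
have e12 j : (0 <= j)%Z -> y1 j = y2 j.
  by move=> hj; rewrite /y1 /y2 /letters /path_through (_ : (0 <=? j)%Z = true) //; lia.
have ne : y1 (-1)%Z <> y2 (-1)%Z.
  (* Since B divides N, the letters at -1 are the lowest digits of w and w'. Were they equal, w and
     w', which share the quotient p, would coincide. *)
  have dBN : B %| N by rewrite /N /nwords expnS dvdn_mulr.
  rewrite /y1 /y2 /letters /path_through /= !modn_dvdm // => h.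
  by move: hw'; rewrite (divn_eq w B) (divn_eq w' B) h e ltnn.
have [[d1 [hd1 p1]]|] := classic (exists d, (1 <= d)%Z /\ forall j, y1 (j + d)%Z = y1 j);
  last by exists y1.
have [[d2 [hd2 p2]]|] := classic (exists d, (1 <= d)%Z /\ forall j, y2 (j + d)%Z = y2 j);
  last by exists y2.
case: ne.
have mult y d m j : (forall j, y (j + d)%Z = y j) -> y (j + Z.of_nat m * d)%Z = y j :> nat.
  move=> hy; elim: m => [|m IH]; first by rewrite Z.add_0_r.
  rewrite -IH -[RHS]hy; congr y; lia.
(* The common period d1 d2 moves the place -1 into the half-line where the two sequences agree. *)
rewrite -(mult y1 d1 (Z.to_nat d2)) // -(mult y2 d2 (Z.to_nat d1)) // e12; last by nia.
by congr y2; nia.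
Qed.

End Graph.

(** * Reduction of real solutions to the graph *)

Delimit Scope R_scope with Re.

Lemma floor_addZ (z : Z) (x : R) : Int_part (IZR z + x)%Re = (z + Int_part x)%Z.
Proof.
have [h1 h2] := base_Int_part x.
by symmetry; apply: Int_part_spec; rewrite plus_IZR; lra.
Qed.

Lemma floor_le (x y : R) : Rle x y -> (Int_part x <= Int_part y)%Z.
Proof.
move=> h; have [h1 h2] := base_Int_part x; have [h3 h4] := base_Int_part y.
suff : (Int_part x < Int_part y + 1)%Z by lia.
by apply: lt_IZR; rewrite plus_IZR; lra.
Qed.

Lemma count_gt1P (P : pred nat) m :
  (exists i j, [/\ i <> j, i < m, j < m, P i & P j]) <-> 1 < count P (iota 0 m).
Proof.
rewrite -size_filter; split=> [[i [j [ij im jm Pi Pj]]]|].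
  apply: (@uniq_leq_size _ [:: i; j]); first by rewrite /= inE andbT; apply/eqP.
  by move=> x; rewrite !inE mem_filter mem_iota => /orP[] /eqP ->; rewrite ?Pi ?Pj.
have : uniq (filter P (iota 0 m)) by rewrite filter_uniq ?iota_uniq.
have : forall x, x \in filter P (iota 0 m) -> P x && (x < m).
  by move=> x; rewrite mem_filter mem_iota.
case: (filter P _) => [|i [|j s]] //= h /andP[hij _] _; exists i, j.
have /andP[-> ->] := h i (mem_head _ _).
have /andP[-> ->] : P j && (j < m) by apply: h; rewrite !inE eqxx orbT.
by split=> // e; rewrite e mem_head in hij.
Qed.

Section Solutions.

Variables (n M : nat) (a : nat -> Z).
Hypothesis n_gt0 : 0 < n.
Hypothesis a_bound : forall i : nat, i <= n -> (0 <= a i <= Z.of_nat M)%Z.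
Hypothesis a0 : a 0 = 0%Z.
Hypothesis an : a n = 0%Z.

Let na i := Z.to_nat (a i).
Let B := M.+1.

Definition attainsZ (F : Z -> Z) (k : Z) (i : nat) : Prop :=
  i <= n /\
  forall l : nat, l <= n -> (a i + F (Z.of_nat i + k) <= a l + F (Z.of_nat l + k))%Z.

Definition solutionZ (F : Z -> Z) : Prop :=
  (forall k, exists i j, [/\ i <> j, attainsZ F k i & attainsZ F k j]) /\
  (forall j, exists2 i, i <= n & attainsZ F (j - Z.of_nat i) i).

(* Rounding down commutes with integer translations and is monotone, so it
   preserves the positions at which minima are attained. *)
Lemma solution_floor y c : tsatisfies n a y -> tminimal n a y ->
  solutionZ (fun j => Int_part (y j + c)%Re).
Proof.
move=> hs hm.
have att k i : attains_min n a y k i -> attainsZ (fun j => Int_part (y j + c)%Re) k i.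
  move=> [hi h]; split=> // l hl; rewrite -!floor_addZ; apply: floor_le.
  have := h l hl; lra.
split=> [k|j].
  by have [i [j [ij [h1 h2]]]] := hs k; exists i, j; split=> //; apply: att.
have [k [h1 [h2 h3]]] := hm j; exists (Z.to_nat (j - k)); first by case: h3.
have -> : (j - Z.of_nat (Z.to_nat (j - k)) = k)%Z by lia.
by apply: att.
Qed.

Lemma solution_real F : solutionZ F ->
  tsatisfies n a (fun j => IZR (F j)) /\ tminimal n a (fun j => IZR (F j)).
Proof.
move=> [hs hm].
have att k i : attainsZ F k i -> attains_min n a (fun j => IZR (F j)) k i.
  by move=> [hi h]; split=> // l hl; rewrite -!plus_IZR; apply/IZR_le/h.
split=> [k|j].
  by have [i [j [ij h1 h2]]] := hs k; exists i, j; split=> //; split; apply: att.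
have [i hi h] := hm j; exists (j - Z.of_nat i)%Z; split; first lia; split; first lia.
have -> : Z.to_nat (j - (j - Z.of_nat i)) = i by lia.
by apply: att.
Qed.

(* Some minimizer at k is not at the right end, and some is not at the left
   end; since a_0 = a_n = 0, the minimum over n consecutive terms is constant. *)
Lemma solution_range F : solutionZ F ->
  exists L, forall j, (L <= F j <= L + Z.of_nat M)%Z.
Proof.
move=> [hs hm].
have right k : exists2 i, i < n & (F (k + Z.of_nat i) <= F (k + Z.of_nat n))%Z.
  have [i [j [ij h1 h2]]] := hs k.
  have [i' hi' h] : exists2 i', i' < n & attainsZ F k i'.
    case: (ltnP i n) => hi; first by exists i.
    by exists j => //; case: h1 h2 => ? _ [? _]; lia.
  exists i' => //; case: h => _ /(_ n (leqnn n)); rewrite an.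
  have := a_bound (ltnW hi'); rewrite !(Z.add_comm k); lia.
have left k : exists2 i, i < n & (F (k + 1 + Z.of_nat i) <= F k)%Z.
  have [i [j [ij h1 h2]]] := hs k.
  have [i' [i0 hi' h]] : exists i', [/\ 0 < i', i' <= n & attainsZ F k i'].
    case: (posnP i) => hi; last by exists i; case: (h1).
    by exists j; case: (h2) => *; split=> //; lia.
  exists i'.-1; first lia.
  case: h => _ /(_ 0 (leq0n n)); rewrite a0; have := a_bound hi'.
  have -> : (k + 1 + Z.of_nat i'.-1 = Z.of_nat i' + k)%Z by lia.
  by rewrite /=; lia.
have [i0 hi0 hmin] : exists2 i0, i0 < n & forall i, i < n -> (F (Z.of_nat i0) <= F (Z.of_nat i))%Z.
  clear -n_gt0; elim: n n_gt0 => [//|[|m] IH] _; first by exists 0 => // -[|i] // _; apply: Z.le_refl.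
  have [//|i hi h] := IH.
  case: (Z.leb_spec (F (Z.of_nat i)) (F (Z.of_nat m.+1))) => hle.
    exists i => [|l]; first lia.
    by rewrite ltnS leq_eqVlt => /orP[/eqP ->|/h].
  exists m.+1 => // l; rewrite ltnS leq_eqVlt => /orP[/eqP ->|/h]; lia.
set L := F (Z.of_nat i0) in hmin.
(* The n terms from k on have minimum L. *)
pose inv k := (forall i, i < n -> (L <= F (k + Z.of_nat i))%Z) /\
              (exists2 i, i < n & F (k + Z.of_nat i)%Z = L).
(* By [right] the term that enters is not below the minimum; by [left], if the term that leaves
   attained it, a remaining one does too. In [down] the two facts exchange roles. *)
have up k : inv k -> inv (k + 1)%Z.
  move=> [h1 [i hi h2]].
  have h1' i' : i' < n -> (L <= F (k + 1 + Z.of_nat i'))%Z.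
    move=> hi'; case: (ltnP i'.+1 n) => hi''.
      have -> : (k + 1 + Z.of_nat i' = k + Z.of_nat i'.+1)%Z by lia.
      exact: h1.
    have [i2 hi2 h] := right k; have := h1 _ hi2.
    have -> : (k + 1 + Z.of_nat i' = k + Z.of_nat n)%Z by lia.
    lia.
  split=> //; case: (posnP i) => [e|hi0'].
    have [i2 hi2 h] := left k; exists i2 => //; have := h1' _ hi2.
    by rewrite e Z.add_0_r in h2; lia.
  exists i.-1; first lia.
  by rewrite -h2; congr F; lia.
have down k : inv (k + 1)%Z -> inv k.
  move=> [h1 [i hi h2]].
  have h1' i' : i' < n -> (L <= F (k + Z.of_nat i'))%Z.
    move=> hi'; case: (posnP i') => hi''.
      have [i2 hi2 h] := left k; have := h1 _ hi2.
      by rewrite hi'' Z.add_0_r; lia.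
    have -> : (k + Z.of_nat i' = k + 1 + Z.of_nat i'.-1)%Z by lia.
    by apply: h1; lia.
  split=> //; case: (ltnP i.+1 n) => [hi'|hi'].
    exists i.+1 => //; rewrite -h2; congr F; lia.
  have [i2 hi2 h] := right k; exists i2 => //; have := h1' _ hi2.
  have e : (k + 1 + Z.of_nat i = k + Z.of_nat n)%Z by lia.
  by rewrite e in h2; lia.
have inv0 : inv 0%Z.
  by split=> [i hi|]; [apply: hmin | exists i0].
have invk k : inv k.
  have pos m : inv (Z.of_nat m).
    elim: m => [//|m IH]; have -> : Z.of_nat m.+1 = (Z.of_nat m + 1)%Z by lia.
    exact: up.
  have neg m : inv (- Z.of_nat m)%Z.
    elim: m => [//|m IH]; apply: down.
    by have -> : (- Z.of_nat m.+1 + 1 = - Z.of_nat m)%Z by lia.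
  case: (Z.leb_spec 0 k) => hk; first by have -> : k = Z.of_nat (Z.to_nat k) by lia.
  by have -> : k = (- Z.of_nat (Z.to_nat (- k)))%Z by lia.
exists L => j; split.
  by have [h _] := invk j; have := h 0 n_gt0; rewrite Z.add_0_r.
(* Minimality gives the upper bound: F j competes in some minimum with a term equal to L, and
   coefficients differ by at most M. *)
have [i hi [_ h]] := hm j.
have [_ [l hl h2]] := invk (j - Z.of_nat i)%Z.
have := h l (ltnW hl); have := a_bound hi; have := a_bound (ltnW hl).
rewrite Z.add_comm in h2; rewrite h2.
have -> : (Z.of_nat i + (j - Z.of_nat i) = j)%Z by lia.
lia.
Qed.

Lemma att_attainsZ (g : Z -> nat) j i k : bounded_seq B g -> i <= n -> k <= n ->
  att n na (dig B (window B g j n.*2.+1)) i k <->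
  attainsZ (fun z => Z.of_nat (g z)) (j + Z.of_nat k) i.
Proof.
move=> hg hi hk.
have digE l : l <= n -> dig B (window B g j n.*2.+1) (l + k) = g (Z.of_nat l + (j + Z.of_nat k))%Z.
  by move=> hl; rewrite /window dig_enc //; [congr g; lia | lia].
have naE l : l <= n -> Z.of_nat (na l) = a l by move=> /a_bound; rewrite /na; lia.
split=> [/allP h|[_ h]].
  split=> // l hl; have := h l; rewrite mem_iota /= add0n ltnS hl => /(_ isT).
  by rewrite !digE // -!naE //; lia.
apply/allP => l; rewrite mem_iota /= add0n ltnS => hl; rewrite !digE //.
by have := h l hl; rewrite -!naE //; lia.
Qed.

(** The window at j encodes the double minimum at j and the minimality at its centre j + n; letting
    j vary, all conditions are met. *)
Lemma solution_admissible (g : Z -> nat) : bounded_seq B g ->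
  solutionZ (fun z => Z.of_nat (g z)) <-> admissible_seq n B na g.
Proof.
move=> hg; split=> [[hs hm] j|h].
  apply/andP; split.
    apply/count_gt1P; have [i [i' [ii h1 h2]]] := hs j; exists i, i'.
    have [[hi _] [hi' _]] := (h1, h2).
    by split=> //; apply/att_attainsZ; rewrite ?Z.add_0_r.
  have [i hi h] := hm (j + Z.of_nat n)%Z; apply/has_iotaP; exists i => //.
  apply/att_attainsZ => //; first exact: leq_subr.
  by have -> : (j + Z.of_nat (n - i) = j + Z.of_nat n - Z.of_nat i)%Z by lia.
split=> j.
  have /andP[/count_gt1P[i [i' [ii hi hi' h1 h2]]] _] := h j; exists i, i'; split=> //.
    by move/att_attainsZ: h1; rewrite Z.add_0_r; apply.
  by move/att_attainsZ: h2; rewrite Z.add_0_r; apply.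
have /andP[_ /has_iotaP[i hi]] := h (j - Z.of_nat n)%Z.
move/att_attainsZ => h1; exists i => //.
have -> : (j - Z.of_nat i = j - Z.of_nat n + Z.of_nat (n - i))%Z by lia.
by apply: h1 => //; apply: leq_subr.
Qed.

Theorem nonperiodic_merging :
  (exists y : Z -> R, ~ tperiodic y /\ tsatisfies n a y /\ tminimal n a y) <->
  merging n B (alive n B na) (B * nwords n B).
Proof.
split=> [[y [hp [hs hm]]]|h]; last first.
  have [//|g [hb hok hp]] := @merging_not_periodic n B na _ h.
  have [h1 h2] := solution_real ((solution_admissible hb).2 hok).
  exists (fun j => IZR (Z.of_nat (g j))); split=> // -[d [hd hd']].
  by apply: hp; exists d; split=> // j; have := eq_IZR _ _ (hd' j); lia.
apply/negPn/negP => hmerge.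
have [//|D D0 hD] := @not_merging_period n B na _ hmerge.
(* D has been fixed before c. Subtracting the lower bound L, which may depend on c, turns the
   rounded sequence into letters 0, ..., M without changing its minimizers or its periods. *)
have per c j : Int_part (y (j + Z.of_nat D)%Z + c)%Re = Int_part (y j + c)%Re.
  have hF := solution_floor c hs hm; set F := (fun j => _) in hF.
  have [L hL] := solution_range hF.
  pose g z := Z.to_nat (F z - L).
  have hg : bounded_seq B g by move=> z; have := hL z; rewrite /g /B; lia.
  have hgF z : Z.of_nat (g z) = (F z - L)%Z by have := hL z; rewrite /g; lia.
  have hok : admissible_seq n B na g.
    apply/solution_admissible => //; case: hF => h1 h2.
    have att k i : attainsZ F k i -> attainsZ (fun z => Z.of_nat (g z)) k i.
      by move=> [hi h]; split=> // l /h; rewrite !hgF; lia.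
    split=> [k|z].
      by have [i [i' [ii ? ?]]] := h1 k; exists i, i'; split=> //; apply: att.
    by have [i hi ?] := h2 z; exists i => //; apply: att.
  have := congr1 Z.of_nat (hD g hg hok j); rewrite !hgF /F; lia.
apply: hp; exists (Z.of_nat D); split=> [|j]; first lia.
have floor0 : Int_part 0 = 0%Z by symmetry; apply: Int_part_spec; lra.
(* With c = -u the left floor is 0, hence 0 <= v - u: the floors of all translates determine a real
   number. *)
have cmp u v : (forall c, Int_part (u + c)%Re = Int_part (v + c)%Re) -> Rle u v.
  move=> e; have := e (- u)%Re; rewrite Rplus_opp_r floor0.
  by have [h1 _] := base_Int_part (v + - u)%Re => h2; rewrite -h2 in h1; lra.
by apply: Rle_antisym; apply: cmp => c; rewrite per.
Qed.

End Solutions.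

(** * Program logic *)

Notation "p ;; q" := (Seq p q) (at level 61, right associativity).

(** A run is asserted to exist, so termination and all the bounds built into [exec] are part of
    every specification. *)
Definition wp (K : nat) (p : prog) (s : store) (Q : store -> Prop) : Prop :=
  exists2 s', exec K p s s' & Q s'.

Definition For (c r : nat) (p : prog) : prog :=
  Do (Clr c);; While false (Eq c r) (p;; Do (Inc c)).

Section Rules.

Variable K : nat.

Lemma wp_do x s Q : fits K x s -> Q (apply x s) -> wp K (Do x) s Q.
Proof. by move=> h hQ; exists (apply x s). Qed.

Lemma wp_seq p q s Q : wp K p s (fun s1 => wp K q s1 Q) -> wp K (p;; q) s Q.
Proof. by move=> [s1 h1 [s2 h2 hQ]]; exists s2 => //; exists s1. Qed.

Lemma wp_when b t p s (Q : store -> Prop) :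
  (eval t s = b -> wp K p s Q) -> (eval t s <> b -> Q s) -> wp K (When b t p) s Q.
Proof.
move=> h1 h2; case: (eval t s =P b) => h.
  by have [s' he hQ] := h1 h; exists s' => //=; rewrite h eqxx.
by exists s; [rewrite /=; case: eqP | apply: h2].
Qed.

Lemma wp_while m (I : nat -> store -> Prop) b t p s (Q : store -> Prop) : m <= K -> I 0 s ->
  (forall j s', j < m -> I j s' -> eval t s' = b /\ wp K p s' (I j.+1)) ->
  (forall s', I m s' -> eval t s' = ~~ b /\ Q s') -> wp K (While b t p) s Q.
Proof.
move=> hm h0 hI hQ.
suff H d j s1 : j + d = m -> I j s1 -> exists2 s', loops (exec K p) b t d s1 s' & Q s'.
  by have [s' h1 h2] := H m 0 s (add0n m) h0; exists s' => //; exists m.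
elim: d j s1 => [|d IH] j s1 e h.
  by rewrite addn0 in e; subst j; have [h1 h2] := hQ _ h; exists s1.
have jm : j < m by lia.
have [h1 [s2 h2 h3]] := hI _ _ jm h.
have ej : j.+1 + d = m by lia.
by have [s' h4 h5] := IH _ _ ej h3; exists s' => //=; split=> //; exists s2.
Qed.

Lemma wp_for c r p (I : nat -> store -> Prop) s (Q : store -> Prop) :
  c != r -> reg s r <= K -> I 0 (setr s c 0) ->
  (forall j s', j < reg s r -> I j s' -> reg s' c = j -> reg s' r = reg s r ->
     wp K p s' (fun s2 => [/\ reg s2 c = j, reg s2 r = reg s r & I j.+1 (setr s2 c j.+1)])) ->
  (forall s', I (reg s r) s' -> reg s' c = reg s r -> reg s' r = reg s r -> Q s') ->
  wp K (For c r p) s Q.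
Proof.
move=> hc hr h0 hI hQ; apply: wp_seq; apply: wp_do => //=.
apply: (@wp_while (reg s r) (fun j s' => [/\ reg s' c = j, reg s' r = reg s r & I j s'])) => //.
- by rewrite /= eqxx eq_sym (negbTE hc).
- move=> j s' hj [e1 e2 h]; rewrite /= e1 e2; split; first by apply/eqP; lia.
  apply: wp_seq; have [s2 he [e3 e4 h']] := hI _ _ hj h e1 e2; exists s2 => //.
  apply: wp_do => /=; first by rewrite e3; apply: leq_trans hr.
  by rewrite /= eqxx eq_sym (negbTE hc) e3 e4.
- by move=> s' [e1 e2 h]; rewrite /= e1 e2 eqxx; split=> //; apply: hQ.
Qed.

End Rules.

(** The frame condition of a subroutine. Registers are numbered so that scratch registers of inner
    routines come after those of their callers; one threshold then describes everything
    preserved. *)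
Definition same (t : nat) (s s' : store) : Prop :=
  (forall x, x < t -> reg s' x = reg s x) /\ arr s' = arr s.

Lemma same_refl t s : same t s s. Proof. by []. Qed.

Lemma same_setr t s s' r v : t <= r -> same t s s' -> same t s (setr s' r v).
Proof.
move=> htr [h1 h2]; split=> // x hx /=; case: eqP => [e|_]; last exact: h1.
by move: htr; rewrite -e leqNgt hx.
Qed.

Lemma same_ext t t' s s' s'' : same t' s' s'' -> t <= t' -> same t s s' -> same t s s''.
Proof.
move=> [h1 h2] htt [h3 h4]; split; last by rewrite h2.
by move=> x hx; rewrite h1 ?h3 //; apply: leq_trans htt.
Qed.

Ltac same_tac := first
  [ exact: same_refl | assumption | apply: same_setr; [by [] | same_tac]
  | match goal with H : same _ _ ?c |- same _ _ ?c =>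
      apply: (same_ext H); [by [] | same_tac] end ].

Ltac reg_tac := simpl; repeat match goal with
  | H : same _ _ ?c |- context [reg ?c ?x] => rewrite (proj1 H x isT)
  | H : same _ _ ?c |- context [arr ?c] => rewrite (proj2 H)
  end.

Lemma setr_setr s r v v' : setr (setr s r v) r v' = setr s r v'.
Proof.
by congr Store; apply: functional_extensionality => x /=; case: eqP.
Qed.

Lemma setr_swap s r r' v v' : r != r' ->
  setr (setr s r v) r' v' = setr (setr s r' v') r v.
Proof.
move=> h; congr Store; apply: functional_extensionality => x /=.
by case: eqP => // ->; rewrite eq_sym (negbTE h).
Qed.

(** A register can only be cleared or incremented, so assignment counts up to the source. *)
Definition copy (j i : nat) : prog := Do (Clr j);; While false (Eq j i) (Do (Inc j)).

Lemma wp_copy K j i s (Q : store -> Prop) : j != i -> reg s i <= K ->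
  Q (setr s j (reg s i)) -> wp K (copy j i) s Q.
Proof.
move=> ji hi hQ; apply: wp_seq; apply: wp_do => //=.
apply: (@wp_while K (reg s i) (fun x s' => s' = setr s j x)) => //.
  move=> x s' hx ->; rewrite /= eqxx [i == j]eq_sym (negbTE ji); split; first by apply/eqP; lia.
  apply: wp_do => /=; rewrite eqxx; last by rewrite setr_setr.
  by apply: leq_trans hi.
by move=> s' ->; rewrite /= eqxx [i == j]eq_sym (negbTE ji) eqxx.
Qed.

Definition add (j i c : nat) : prog := For c i (Do (Inc j)).

Lemma wp_add K j i c s (Q : store -> Prop) : j != i -> c != i -> c != j ->
  reg s j + reg s i <= K ->
  Q (setr (setr s c (reg s i)) j (reg s j + reg s i)) -> wp K (add j i c) s Q.
Proof.
move=> ji ci cj hK hQ.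
apply: (@wp_for _ _ _ _ (fun x s' => s' = setr (setr s c x) j (reg s j + x))) => //.
- lia.
- by rewrite addn0 /setr /=; congr Store; apply: functional_extensionality => x; case: (x =P j) => // ->; rewrite eq_sym (negbTE cj).
- move=> x s' hx -> _ _; apply: wp_do => /=; rewrite eqxx; first by lia.
  split=> /=; first by rewrite (negbTE cj) eqxx.
    by rewrite [i == j]eq_sym (negbTE ji) [i == c]eq_sym (negbTE ci).
  rewrite setr_setr setr_swap ?setr_setr 1?eq_sym // addnS setr_swap //.
- by move=> s' -> _ _.
Qed.

(** [modnS] and [divnS] branch on divisibility of m + 1, whereas a program compares the incremented
    remainder with d. *)
Lemma dvdnS_mod d m : 0 < d -> (d %| m.+1) = ((m %% d).+1 == d).
Proof.
move=> d0; rewrite /dvdn -addn1 -modnDml addn1.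
have := ltn_pmod m d0; rewrite leq_eqVlt => /orP[/eqP ->|h]; first by rewrite modnn !eqxx.
by rewrite modn_small // (ltn_eqF h).
Qed.

(** * Testing a window *)

(** Up to [r_one] these are parameters, constant after the setup; then come the answer, the
    registers of the outer loops, and the scratch space of ever deeper subroutines. *)
Notation r_zero := 0 (only parsing).
Notation r_n := 1 (only parsing).
Notation r_n1 := 2 (only parsing).
Notation r_B := 3 (only parsing).
Notation r_base := 4 (only parsing).
Notation r_len := 5 (only parsing).
Notation r_N := 6 (only parsing).
Notation r_one := 7 (only parsing).
Notation r_ans := 8 (only parsing).
Notation r_u := 9 (only parsing).
Notation r_p := 10 (only parsing).
Notation r_q := 11 (only parsing).
Notation r_c := 12 (only parsing).
Notation r_i := 13 (only parsing).
Notation r_k := 14 (only parsing).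
Notation r_cnt := 15 (only parsing).
Notation r_cov := 16 (only parsing).
Notation r_att := 17 (only parsing).
Notation r_l := 18 (only parsing).
Notation r_x := 19 (only parsing).
Notation r_arg := 20 (only parsing).
Notation r_v := 21 (only parsing).
Notation r_pos := 22 (only parsing).
Notation r_ct := 23 (only parsing).
Notation r_idx := 24 (only parsing).
Notation r_t := 25 (only parsing).
Notation r_ct2 := 26 (only parsing).
Notation r_quo := 27 (only parsing).
Notation r_rem := 28 (only parsing).
Notation r_ct3 := 29 (only parsing).

Notation t_in := 0 (only parsing).
Notation t_alive := 1 (only parsing).
Notation t_hasin := 2 (only parsing).
Notation t_hasout := 3 (only parsing).

Definition divmod : prog :=
  Do (Clr r_quo);; Do (Clr r_rem);;
  For r_ct3 r_t (Do (Inc r_rem);;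
    When true (Eq r_rem r_B) (Do (Clr r_rem);; Do (Inc r_quo))).

Lemma wp_divmod K s (Q : store -> Prop) : 0 < reg s r_B -> reg s r_t <= K ->
  (forall s', same r_quo s s' -> reg s' r_quo = reg s r_t %/ reg s r_B ->
     reg s' r_rem = reg s r_t %% reg s r_B -> Q s') ->
  wp K divmod s Q.
Proof.
move=> B0 hx hQ; set B := reg s r_B in B0 hQ; set x := reg s r_t in hx hQ.
apply: wp_seq; apply: wp_do => //; apply: wp_seq; apply: wp_do => //=.
apply: (@wp_for _ _ _ _ (fun j s' =>
  [/\ same r_quo s s', reg s' r_quo = j %/ B & reg s' r_rem = j %% B])) => //=.
- by rewrite div0n mod0n; split=> //; same_tac.
- move=> j s'; rewrite -/x => hj [h1 h2 h3] e1 e2.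
  have hd := leq_div j B; have hm := leq_mod j B.
  have hmS := modnS j B; have hdS := divnS j B0; rewrite dvdnS_mod // in hmS hdS.
  apply: wp_seq; apply: wp_do => /=; first by lia.
  apply: wp_when => /=; reg_tac; rewrite -/B h3.
    move=> e; rewrite e /= in hmS hdS; apply: wp_seq; apply: wp_do => //.
    apply: wp_do => /=; first by lia.
    split=> //=; split; [by same_tac | by rewrite hdS h2 | by rewrite hmS].
  move=> e; have ef : ((j %% B).+1 == B) = false by apply/negP.
  rewrite ef /= in hmS hdS.
  by split=> //=; split; [same_tac | rewrite hdS h2 | rewrite hmS].
- by move=> s' [h1 h2 h3] _ _; apply: hQ.
Qed.

Definition getdig : prog :=
  copy r_t r_u;; For r_ct2 r_idx (divmod;; copy r_t r_quo);; divmod.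

Lemma wp_getdig K s (Q : store -> Prop) : 0 < reg s r_B -> reg s r_u <= K -> reg s r_idx <= K ->
  (forall s', same r_t s s' -> reg s' r_rem = dig (reg s r_B) (reg s r_u) (reg s r_idx) -> Q s') ->
  wp K getdig s Q.
Proof.
move=> B0 hu hi hQ; set B := reg s r_B in B0 hQ; set u := reg s r_u in hu hQ.
apply: wp_seq; apply: wp_copy => //; rewrite -/u; apply: wp_seq.
apply: (@wp_for _ _ _ _ (fun j s' => same r_t s s' /\ reg s' r_t = u %/ B ^ j)) => //=.
- by rewrite expn0 divn1; split=> //; same_tac.
- move=> j s' hj [h1 h2] e1 e2; have hd := leq_div u (B ^ j).
  apply: wp_seq; apply: wp_divmod; rewrite ?h2; reg_tac => //; first by lia.
  rewrite -/B => s2 h3 h4 h5; have hd' := leq_div (u %/ B ^ j) B.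
  apply: wp_copy => //; first by lia.
  split=> /=; reg_tac => //; split; first by same_tac.
  by rewrite /= h4 expnSr divnMA.
- move=> s' [h1 h2] _ _; have hd := leq_div u (B ^ reg s r_idx).
  apply: wp_divmod; rewrite ?h2; reg_tac => //; first by lia.
  rewrite -/B => s2 h3 h4 h5; apply: hQ; first by same_tac.
  by rewrite h5.
Qed.

(** Adds the length of one unary block to a register and stops on the terminating 0, which the
    caller skips. *)
Definition scan (r : nat) : prog :=
  While true (Get t_in r_pos) (Do (Inc r_pos);; Do (Inc r)).

Lemma wp_scan K r m s (Q : store -> Prop) : r != r_pos ->
  (forall z, z < m -> arr s t_in (reg s r_pos + z)) -> arr s t_in (reg s r_pos + m) = false ->
  reg s r_pos + m <= K -> reg s r + m <= K ->
  Q (setr (setr s r_pos (reg s r_pos + m)) r (reg s r + m)) -> wp K (scan r) s Q.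
Proof.
move=> hr h1 h2 hp hv hQ.
apply: (@wp_while K m (fun j s' =>
  s' = setr (setr s r_pos (reg s r_pos + j)) r (reg s r + j))) => //.
- lia.
- rewrite !addn0 /setr /=; case: s {h1 h2 hp hv hQ} => R A /=; congr Store.
  apply: functional_extensionality => x /=; case: (x =P r) => [->//|_].
  by case: eqP => [->|].
- move=> j s' hj ->; rewrite /= [r_pos == r]eq_sym (negbTE hr) /= h1 //; split=> //.
  apply: wp_seq; apply: wp_do => /=; rewrite [r_pos == r]eq_sym (negbTE hr) /=; first by lia.
  apply: wp_do => /=; rewrite (negbTE hr) eqxx; first by lia.
  rewrite setr_swap 1?eq_sym // setr_setr -setr_swap 1?eq_sym // setr_setr !addnS //.
- by move=> s' ->; rewrite /= [r_pos == r]eq_sym (negbTE hr) /= h2.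
Qed.

(** Arrays hold single bits, so a coefficient is read afresh from the input each time, past the
    blocks that precede it. *)
Definition geta : prog :=
  copy r_pos r_base;; For r_ct r_arg (Do (Clr r_v);; scan r_v;; Do (Inc r_pos));;
  Do (Clr r_v);; scan r_v.

Definition val_prog : prog :=
  geta;; copy r_idx r_k;; add r_idx r_arg r_ct;; getdig;; add r_v r_rem r_ct.

(** Registers can only be tested for equality. A value v is smaller than x exactly when a counter
    running through 0, ..., x - 1 meets v, and then the flag is cleared. *)
Definition att_prog : prog :=
  Do (Clr r_att);; Do (Inc r_att);; copy r_arg r_i;; val_prog;; copy r_x r_v;;
  For r_l r_n1 (copy r_arg r_l;; val_prog;;
    For r_ct r_x (When true (Eq r_ct r_v) (Do (Clr r_att)))).

(** The shift n - i is found by counting from i up to n. That the count of minimizers exceeds 1 is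
    tested as its being neither 0 nor 1. *)
Definition check_prog : prog :=
  Do (Clr r_cnt);; Do (Clr r_cov);;
  For r_i r_n1 (
    Do (Clr r_k);; att_prog;; When false (Eq r_att r_zero) (Do (Inc r_cnt));;
    Do (Clr r_k);; copy r_ct r_i;;
    While false (Eq r_ct r_n) (Do (Inc r_ct);; Do (Inc r_k));;
    att_prog;; When false (Eq r_att r_zero) (Do (Clr r_cov);; Do (Inc r_cov)));;
  Do (Put t_alive r_u true);;
  When true (Eq r_cnt r_zero) (Do (Put t_alive r_u false));;
  When true (Eq r_cnt r_one) (Do (Put t_alive r_u false));;
  When true (Eq r_cov r_zero) (Do (Put t_alive r_u false)).

Section Check.

Variables (K n B base : nat) (na : nat -> nat) (w : seq bool).
Let N := nwords n B.

(** Where the unary block of coefficient i starts in the input; the successor accounts for the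
    terminator of each earlier block. *)
Fixpoint offset (i : nat) : nat := if i is j.+1 then offset j + (na j).+1 else base.

Record env (s : store) : Prop := Env {
  env_zero : reg s r_zero = 0;
  env_n : reg s r_n = n;
  env_n1 : reg s r_n1 = n.+1;
  env_B : reg s r_B = B;
  env_base : reg s r_base = base;
  env_N : reg s r_N = N;
  env_one : reg s r_one = 1;
  env_in : forall z, arr s t_in z = nth false w z }.

Hypothesis B0 : 0 < B.
Hypothesis na_lt : forall i, i <= n -> na i < B.
Hypothesis coef_true : forall i z, i <= n -> z < na i -> nth false w (offset i + z).
Hypothesis coef_end : forall i, i <= n -> nth false w (offset i + na i) = false.
Hypothesis K_offset : forall i, i <= n -> offset i + na i < K.
Hypothesis K_B : B + B <= K.
Hypothesis K_n : (n + n).+2 <= K.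

Lemma env_same t s s' : r_ans <= t -> same t s s' -> env s -> env s'.
Proof.
move=> ht [h1 h2] [*]; split; rewrite ?h1 //; try by apply: leq_trans ht.
by rewrite h2.
Qed.

Lemma wp_geta s (Q : store -> Prop) : env s -> reg s r_arg <= n ->
  (forall s', same r_v s s' -> reg s' r_v = na (reg s r_arg) -> Q s') -> wp K geta s Q.
Proof.
move=> hs hi hQ; set i := reg s r_arg in hi hQ.
have Ko := K_offset.
have base_le j : base <= offset j by elim: j => //= j; lia.
apply: wp_seq; apply: wp_copy => //.
  by rewrite (env_base hs); have := base_le 0; have := Ko 0 isT; lia.
rewrite (env_base hs); apply: wp_seq.
apply: (@wp_for _ _ _ _ (fun j s' => same r_v s s' /\ reg s' r_pos = offset j)) => //=.
- by rewrite -/i; lia.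
- by split=> //; same_tac.
- rewrite -/i => j s' hj [h1 h2] e1 e2; have jn : j <= n by lia.
  have hk := Ko j jn; apply: wp_seq; apply: wp_do => //; apply: wp_seq.
  have hs' := env_same (isT : r_ans <= r_v) h1 hs.
  apply: (@wp_scan _ _ (na j)) => //=; rewrite ?h2; try lia.
  + by move=> z hz; rewrite (env_in hs') coef_true.
  + by rewrite (env_in hs') coef_end.
  apply: wp_do => /=; first by lia.
  by split=> //=; split; [same_tac | rewrite addnS].
- rewrite -/i => s' [h1 h2] _ _; have hk := Ko i hi.
  apply: wp_seq; apply: wp_do => //=.
  have hs' := env_same (isT : r_ans <= r_v) h1 hs.
  apply: (@wp_scan _ _ (na i)) => //=; rewrite ?h2; try lia.
  + by move=> z hz; rewrite (env_in hs') coef_true.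
  + by rewrite (env_in hs') coef_end.
  by apply: hQ => //=; same_tac.
Qed.

Lemma wp_val s (Q : store -> Prop) : env s -> reg s r_arg <= n -> reg s r_k <= n ->
  reg s r_u <= K ->
  (forall s', same r_v s s' ->
     reg s' r_v = na (reg s r_arg) + dig B (reg s r_u) (reg s r_arg + reg s r_k) -> Q s') ->
  wp K val_prog s Q.
Proof.
move=> hs hi hk hu hQ; apply: wp_seq; apply: wp_geta => // s1 h1 e1.
apply: wp_seq; apply: wp_copy => //; reg_tac; first by lia.
apply: wp_seq; apply: wp_add => //; reg_tac; first by lia.
have hs1 := env_same (isT : r_ans <= r_v) h1 hs.
apply: wp_seq; apply: wp_getdig => //=; rewrite ?(env_B hs1) //; reg_tac => //; first by lia.
move=> s2 h2; reg_tac => e2.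
have hdig : reg s2 r_rem < B by rewrite e2 ltn_mod.
have := na_lt hi => hna.
have e3 : reg s2 r_v = na (reg s r_arg) by rewrite (proj1 h2 r_v isT) /= e1.
apply: wp_add => //; rewrite e3; first by lia.
apply: hQ; first by same_tac.
by rewrite /= e2 addnC [reg s r_k + _]addnC addnC.
Qed.

Lemma wp_att s (Q : store -> Prop) : env s -> reg s r_i <= n -> reg s r_k <= n ->
  reg s r_u <= K ->
  (forall s', same r_att s s' ->
     reg s' r_att = att n na (dig B (reg s r_u)) (reg s r_i) (reg s r_k) -> Q s') ->
  wp K att_prog s Q.
Proof.
move=> hs hi hk hu hQ.
set u := reg s r_u in hu hQ; set i := reg s r_i in hi hQ; set k := reg s r_k in hk hQ.
pose val l := na l + dig B u (l + k).
have val_lt l : l <= n -> val l < K.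
  move=> hl; have := na_lt hl; have : dig B u (l + k) < B by rewrite ltn_mod.
  by rewrite /val; lia.
apply: wp_seq; apply: wp_do => //; apply: wp_seq; apply: wp_do => //=; first by lia.
apply: wp_seq; apply: wp_copy => //=; first by rewrite -/i; lia.
rewrite -/i; apply: wp_seq.
set s0 := setr _ _ _; have h0 : same r_att s s0 by rewrite /s0; same_tac.
have hs0 := env_same (isT : r_ans <= r_att) h0 hs.
apply: wp_val => // s1 h1 /=; rewrite -/u -/i -/k -/(val i) => e1.
have e1' : reg s1 r_att = 1 by rewrite (proj1 h1 r_att isT).
have {}h1 : same r_att s s1 by same_tac.
have hs1 := env_same (isT : r_ans <= r_att) h1 hs.
apply: wp_seq; apply: wp_copy => //; first by rewrite e1 ltnW ?val_lt.
pose le_all j := all (fun l => val i <= val l) (iota 0 j).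
have le_allS j : le_all j.+1 = le_all j && (val i <= val j).
  by rewrite /le_all -[j.+1]addn1 iotaD all_cat /= andbT.
rewrite e1; apply: (@wp_for _ _ _ _ (fun j s' =>
  [/\ same r_att s s', reg s' r_x = val i & reg s' r_att = le_all j])) => //=.
- by rewrite (env_n1 hs1); lia.
- by split=> //; same_tac.
- rewrite (env_n1 hs1) => j s2 hj [h2 e2 e3] e4 e5; have jn : j <= n by lia.
  have hs2 := env_same (isT : r_ans <= r_att) h2 hs.
  apply: wp_seq; apply: wp_copy => //; first by lia.
  apply: wp_seq; apply: wp_val => /=; rewrite ?e4; reg_tac => //.
    by apply: (env_same _ _ hs2) => //; same_tac.
  move=> s3 h3; rewrite -/u -/k -/(val j) => e6.
  have hx : reg s3 r_x = val i by rewrite (proj1 h3 r_x isT) /= e2.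
  have hl : reg s3 r_l = j by rewrite (proj1 h3 r_l isT) /= e4.
  have ha : reg s3 r_att = reg s2 r_att by rewrite (proj1 h3 r_att isT).
  have {}h3 : same r_att s s3 by same_tac.
  have hs3 := env_same (isT : r_ans <= r_att) h3 hs.
  apply: (@wp_for _ _ _ _ (fun c s' => [/\ same r_att s s', reg s' r_x = val i,
    reg s' r_l = j, reg s' r_v = val j &
    reg s' r_att = (reg s2 r_att != 0) && ~~ (val j < c)])) => //=.
  + by rewrite hx ltnW ?val_lt.
  + split=> //; first by same_tac.
    by rewrite andbT ha e3; case: (le_all _).
  + move=> c s4 hc [h4 e7 e8 e9 e10] e11 e12.
    apply: wp_when => /=; rewrite e11 e9.
      move=> /eqP ec; apply: wp_do => //=; split=> //; split=> //=; first by same_tac.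
      by rewrite ec ltnSn andbF.
    move=> /eqP ec; split=> //; split=> //=; first by same_tac.
    by rewrite e10; congr (nat_of_bool (_ && ~~ _)); apply/idP/idP; lia.
  + rewrite hx => s4 [h4 e7 e8 e9 e10] _ _; split=> //=.
      by rewrite (env_n1 (env_same (isT : r_ans <= r_att) h4 hs)).
    split=> //=; first by same_tac.
    by rewrite e10 e3 -leqNgt le_allS; case: (le_all _).
- by rewrite (env_n1 hs1) => s' [h2 _ e2] _ _; apply: hQ.
Qed.

Lemma wp_check s (Q : store -> Prop) : env s -> reg s r_u <= K ->
  (forall s', (forall x, x < r_i -> reg s' x = reg s x) ->
     (forall a z, arr s' a z = if (a == t_alive) && (z == reg s r_u)
        then admissible n B na (reg s r_u) else arr s a z) -> Q s') ->
  wp K check_prog s Q.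
Proof.
move=> hs hu hQ; set u := reg s r_u in hu hQ; pose d := dig B u.
pose cnt j := count (fun i => att n na d i 0) (iota 0 j).
pose cov j := has (fun i => att n na d i (n - i)) (iota 0 j).
have cntS j : cnt j.+1 = cnt j + att n na d j 0.
  by rewrite /cnt -[j.+1]addn1 iotaD count_cat /= addn0.
have covS j : cov j.+1 = cov j || att n na d j (n - j).
  by rewrite /cov -[j.+1]addn1 iotaD has_cat /= orbF.
apply: wp_seq; apply: wp_do => //; apply: wp_seq; apply: wp_do => //=; apply: wp_seq.
apply: (@wp_for _ _ _ _ (fun j s' => [/\ same r_i s s',
  reg s' r_cnt = cnt j &
  reg s' r_cov = cov j])) => //=.
- by rewrite (env_n1 hs); lia.
- by split=> //; same_tac.
- rewrite (env_n1 hs) => j s1 hj [h1 e1 e2] e3 e4; have jn : j <= n by lia.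
  have hs1 := env_same (isT : r_ans <= r_i) h1 hs.
  apply: wp_seq; apply: wp_do => //=; apply: wp_seq.
  apply: wp_att => /=; rewrite ?e3 //; reg_tac => //.
    by apply: (env_same _ _ hs1) => //; same_tac.
  rewrite -/u -/d => s2 h2 e5.
  have f1 : reg s2 r_cnt = reg s1 r_cnt by rewrite (proj1 h2 r_cnt isT).
  have f2 : reg s2 r_cov = reg s1 r_cov by rewrite (proj1 h2 r_cov isT).
  have f3 : reg s2 r_i = j by rewrite (proj1 h2 r_i isT).
  have {}h2 : same r_i s s2 by same_tac.
  have hs2 := env_same (isT : r_ans <= r_i) h2 hs.
  have cK : cnt j <= j.
    by rewrite -[leqRHS](size_iota 0) /cnt count_size.
  pose b := att n na d j 0.
  (* The branches of the conditional join here, with the count raised by b. *)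
  suff H s3 : same r_i s s3 -> reg s3 r_cov = reg s1 r_cov -> reg s3 r_i = j ->
      reg s3 r_cnt = reg s1 r_cnt + b -> wp K (Do (Clr r_k);; copy r_ct r_i;;
        While false (Eq r_ct r_n) (Do (Inc r_ct);; Do (Inc r_k));;
        att_prog;; When false (Eq r_att r_zero) (Do (Clr r_cov);; Do (Inc r_cov))) s3
      (fun s' => [/\ reg s' r_i = j, reg s' r_n1 = n.+1 &
       [/\ same r_i s (setr s' r_i j.+1),
          reg (setr s' r_i j.+1) r_cnt = cnt j.+1 &
          reg (setr s' r_i j.+1) r_cov = cov j.+1]]).
    apply: wp_seq; apply: wp_when => /=; rewrite e5 (env_zero hs2) eqb0 => hb.
      apply: wp_do => /=; first by rewrite f1 e1; lia.
      by apply: H => //=; [same_tac | rewrite f1 /b (negbFE hb) addn1].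
    by apply: H => //=; rewrite f1 /b; move: hb; case: (att _ _ _ _ _) => //; rewrite addn0.
  move=> {s2 h2 hs2 e5 f1 f2 f3} h3 f1 f2 f3.
  have hs3 := env_same (isT : r_ans <= r_i) h3 hs.
  apply: wp_seq; apply: wp_do => //=; apply: wp_seq; apply: wp_copy => //=.
    by rewrite f2; lia.
  rewrite f2; apply: wp_seq.
  apply: (@wp_while _ (n - j) (fun c s' => [/\ same r_i s s', reg s' r_cov = reg s1 r_cov,
    reg s' r_i = j, reg s' r_cnt = reg s1 r_cnt + b &
    reg s' r_ct = j + c /\ reg s' r_k = c])) => //=; first by lia.
  + by split=> //; [same_tac | rewrite addn0].
  + move=> c s4 hc [h4 g1 g2 g3 [g4 g5]].
    have hs4 := env_same (isT : r_ans <= r_i) h4 hs.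
    split; first by rewrite g4 (env_n hs4); apply/eqP; lia.
    apply: wp_seq; apply: wp_do => /=; first by lia.
    apply: wp_do => /=; first by lia.
    by split=> //=; [same_tac | rewrite g4 g5 addnS].
  move=> s4 [h4 g1 g2 g3 [g4 g5]].
  have hs4 := env_same (isT : r_ans <= r_i) h4 hs.
  split; first by rewrite g4 (env_n hs4); apply/eqP; lia.
  apply: wp_seq; apply: wp_att => //; rewrite ?g2 ?g5; reg_tac => //.
    by rewrite leq_subr.
  rewrite -/u -/d => s5 h5 e5.
  have k1 : reg s5 r_cnt = reg s1 r_cnt + b by rewrite (proj1 h5 r_cnt isT).
  have k2 : reg s5 r_cov = reg s1 r_cov by rewrite (proj1 h5 r_cov isT).
  have k3 : reg s5 r_i = j by rewrite (proj1 h5 r_i isT).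
  have {}h5 : same r_i s s5 by same_tac.
  have hs5 := env_same (isT : r_ans <= r_i) h5 hs.
  have cE : reg s5 r_cnt = cnt j.+1.
    by rewrite k1 e1 cntS.
  apply: wp_when => /=; rewrite e5 (env_zero hs5) eqb0 covS => hb.
    apply: wp_seq; apply: wp_do => //=; apply: wp_do => /=; first by lia.
    split=> //=; first exact: (env_n1 hs5).
    by split=> //=; [same_tac | rewrite (negbFE hb) orbT].
  split=> //=; first exact: (env_n1 hs5).
  split=> //=; first by same_tac.
  by rewrite k2 e2; move: hb; case: (att _ _ _ _ (n - j)) => //; rewrite orbF.
rewrite (env_n1 hs) => s1 [h1 e1 e2] _ _.
have hs1 := env_same (isT : r_ans <= r_i) h1 hs.
have hu1 : reg s1 r_u = u by rewrite (proj1 h1 r_u isT).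
(* Each of the three erasing tests conjoins one inequality of registers to the bit in cell u. *)
pose put (b : bool) (s' : store) := reg s' = reg s1 /\
  forall a z, arr s' a z = if (a == t_alive) && (z == u) then b else arr s a z.
have wp_put x y b s' (R : store -> Prop) : put b s' ->
    (forall s2, put (b && (reg s1 x != reg s1 y)) s2 -> R s2) ->
    wp K (When true (Eq x y) (Do (Put t_alive r_u false))) s' R.
  move=> [p1 p2] hR; apply: wp_when => /=; rewrite p1 => /= hb.
    apply: wp_do => //=; apply: hR; split=> //= a z; rewrite p1 hu1 hb andbF p2.
    by case: ((a == t_alive) && _).
  by apply: hR; split=> // a z; move/negP: hb => ->; rewrite andbT.
apply: wp_seq; apply: wp_do => //=; apply: wp_seq.
apply: (wp_put _ _ true).
  by split=> //= a z; rewrite hu1 (proj2 h1).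
move=> s2 p2; apply: wp_seq; apply: (wp_put _ _ _ _ _ p2) => s3 p3; apply: (wp_put _ _ _ _ _ p3) => s4 [p4 q4].
apply: hQ => [x hx|a z]; first by rewrite p4 (proj1 h1).
rewrite q4; case: ifP => // _; rewrite /admissible -/d.
rewrite (env_zero hs1) (env_one hs1) e1 e2 eqb0 negbK; congr (_ && _).
by rewrite -/(cnt n.+1); case: (cnt _) => [|[|c]].
Qed.

End Check.

(** * Trimming *)

(* Runs the body on all edges w < B N, with r_p = w / B and r_q = w mod N. *)
Definition sweep (body : prog) : prog :=
  Do (Clr r_p);; Do (Clr r_q);; Do (Clr r_c);;
  While false (Eq r_p r_N) (
    body;;
    Do (Inc r_q);; When true (Eq r_q r_N) (Do (Clr r_q));;
    Do (Inc r_c);; When true (Eq r_c r_B) (Do (Clr r_c);; Do (Inc r_p))).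

Definition on_edge (p : prog) : prog :=
  When true (Get t_alive r_p) (When true (Get t_alive r_q) p).

(** All flags are computed before any vertex is erased, so that a round is the simultaneous [trim]
    and not a sequential variant. *)
Definition round : prog :=
  For r_i r_N (Do (Put t_hasin r_i false);; Do (Put t_hasout r_i false));;
  sweep (on_edge (Do (Put t_hasin r_p true);; Do (Put t_hasout r_q true)));;
  For r_i r_N (
    When false (Get t_hasin r_i) (Do (Put t_alive r_i false));;
    When false (Get t_hasout r_i) (Do (Put t_alive r_i false))).

(** The flags now mark the vertices already reached by an edge; arriving at a marked vertex a second
    time is a merging. *)
Definition final : prog :=
  For r_i r_N (Do (Put t_hasin r_i false));;
  sweep (on_edge (
    When true (Get t_hasin r_p) (Do (Clr r_ans);; Do (Inc r_ans));;
    Do (Put t_hasin r_p true))).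

Definition decide : prog :=
  For r_u r_N check_prog;; For r_u r_N round;; final.

Section Trimming.

Variables (K n B base : nat) (na : nat -> nat) (w : seq bool).
Let N := nwords n B.
Let env := env n B base w.

Hypothesis B0 : 0 < B.
Hypothesis K_BN : B * N <= K.

Let N0 : 0 < N. Proof. exact: N_gt0. Qed.
Let K_N : N <= K. Proof. by apply: leq_trans K_BN; rewrite leq_pmull. Qed.

Lemma env_regs s s' : (forall x, x < r_ans -> reg s' x = reg s x) ->
  arr s' t_in = arr s t_in -> env s -> env s'.
Proof. by move=> h1 h2 [*]; split; rewrite ?h1 // h2. Qed.

(** Three counters that wrap around keep w / B, w mod N and w mod B up to date, so no division is
    performed. The invariant must not depend on them, which is what its stability under [same r_p]
    says. *)
Lemma wp_sweep body (I : nat -> store -> Prop) s (Q : store -> Prop) :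
  reg s r_B = B -> reg s r_N = N ->
  (forall m s1 s2, same r_p s1 s2 -> I m s1 -> I m s2) -> I 0 s ->
  (forall m s1, m < B * N -> I m s1 -> reg s1 r_p = m %/ B -> reg s1 r_q = m %% N ->
    wp K body s1 (fun s2 => I m.+1 s2 /\
      forall x, x \in [:: r_B; r_N; r_p; r_q; r_c] -> reg s2 x = reg s1 x)) ->
  (forall s', I (B * N) s' -> Q s') -> wp K (sweep body) s Q.
Proof.
move=> hB hN hst h0 hI hQ.
apply: wp_seq; apply: wp_do => //; apply: wp_seq; apply: wp_do => //.
apply: wp_seq; apply: wp_do => //=.
apply: (@wp_while K (B * N) (fun m s' => I m s' /\ [/\ reg s' r_B = B, reg s' r_N = N,
  reg s' r_p = m %/ B, reg s' r_q = m %% N & reg s' r_c = m %% B])) => //.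
- split; last by split=> //=; rewrite ?div0n ?mod0n.
  by apply: hst h0; same_tac.
- move=> m s1 hm [h [e1 e2 e3 e4 e5]] /=; have hp := divB_lt B0 hm.
  rewrite e3 e2; split; first by rewrite ltn_eqF.
  apply: wp_seq; have [s2 he [h' hk]] := hI m s1 hm h e3 e4; exists s2 => //.
  have [f1 f2 f3 f4 f5] : [/\ reg s2 r_B = B, reg s2 r_N = N, reg s2 r_p = m %/ B,
    reg s2 r_q = m %% N & reg s2 r_c = m %% B] by rewrite !hk.
  have hq : m %% N < N by rewrite ltn_mod.
  have hc : m %% B < B by rewrite ltn_mod.
  have BN : B <= N by rewrite /N /nwords expnS leq_pmulr // expn_gt0 B0.
  have hqS := modnS m N; have hcS := modnS m B; have hpS := divnS m B0.
  rewrite !dvdnS_mod // in hqS hcS hpS.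
  apply: wp_seq; apply: wp_do => /=; first by lia.
  suff H s3 : same r_p s2 s3 -> reg s3 r_p = m %/ B -> reg s3 r_q = m.+1 %% N ->
      reg s3 r_c = m %% B ->
      wp K (Do (Inc r_c);; When true (Eq r_c r_B) (Do (Clr r_c);; Do (Inc r_p))) s3
        (fun s' => I m.+1 s' /\ [/\ reg s' r_B = B, reg s' r_N = N,
           reg s' r_p = m.+1 %/ B, reg s' r_q = m.+1 %% N & reg s' r_c = m.+1 %% B]).
    apply: wp_seq; apply: wp_when => /=; rewrite f4 f2 => hb.
      rewrite hb in hqS; apply: wp_do => //=; apply: H => //; by same_tac.
    have hb' : ((m %% N).+1 == N) = false by apply/negP.
    by rewrite hb' in hqS; apply: H => //=; same_tac.
  move=> h3 g3 g4 g5.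
  apply: wp_seq; apply: wp_do => /=; first by lia.
  have [g1 g2] : reg s3 r_B = B /\ reg s3 r_N = N by rewrite !(proj1 h3).
  apply: wp_when => /=; rewrite g5 g1 => hb.
    rewrite hb in hcS hpS; apply: wp_seq; apply: wp_do => //=; apply: wp_do => /=.
      by rewrite g3; lia.
    split; last by split=> //=; rewrite g3 hpS.
    by apply: hst h'; same_tac.
  have hb' : ((m %% B).+1 == B) = false by apply/negP.
  rewrite hb' in hcS hpS.
  split; last by split=> //=; rewrite ?g3 ?g5 ?hpS ?hcS.
  by apply: hst h'; same_tac.
- move=> s1 [h [e1 e2 e3 e4 e5]] /=; rewrite e3 e2 mulKn // eqxx; split=> //.
  exact: hQ.
Qed.

Lemma wp_on_edge p s (Q : store -> Prop) m :
  reg s r_p = m %/ B -> reg s r_q = m %% N ->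
  (edge n B (arr s t_alive) m -> wp K p s Q) ->
  (edge n B (arr s t_alive) m = false -> Q s) -> wp K (on_edge p) s Q.
Proof.
move=> ep eq h1 h2; rewrite /edge in h1 h2.
apply: wp_when => /=; rewrite ep => hp; last by apply: h2; rewrite (negbTE (introN idP hp)).
apply: wp_when => /=; rewrite eq => hq; first by apply: h1; rewrite hp hq.
by apply: h2; rewrite [X in _ && X](negbTE (introN idP hq)) andbF.
Qed.

Lemma has_inS X u m : has_in n B X u m.+1 = has_in n B X u m || ((m %/ B == u) && edge n B X m).
Proof. by rewrite /has_in -addn1 iotaD has_cat /= orbF. Qed.

Lemma has_outS X u m :
  has_out n B X u m.+1 = has_out n B X u m || ((m %% N == u) && edge n B X m).
Proof. by rewrite /has_out -addn1 iotaD has_cat /= orbF. Qed.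

Lemma mergingS X m :
  merging n B X m.+1 = merging n B X m || (edge n B X m && has_in n B X (m %/ B) m).
Proof. by rewrite /merging -addn1 iotaD has_cat /= orbF. Qed.

Lemma wp_clear_unless a s (Q : store -> Prop) : a != t_alive ->
  (forall s', reg s' = reg s -> (forall b, b != t_alive -> arr s' b = arr s b) ->
     (forall z, arr s' t_alive z =
        if z == reg s r_i then arr s t_alive z && arr s a z else arr s t_alive z) -> Q s') ->
  wp K (When false (Get a r_i) (Do (Put t_alive r_i false))) s Q.
Proof.
move=> ha hQ; apply: wp_when => /= h.
  apply: wp_do => //=; apply: hQ => //= [b /negbTE hb|z].
    by apply: functional_extensionality => z /=; rewrite hb.
  by case: eqP => // ->; rewrite h andbF.
apply: hQ => // z; case: eqP => // ->.
by move: h; case: (arr s a _) => //; rewrite andbT.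
Qed.

Lemma wp_round s (Q : store -> Prop) : env s ->
  (forall s', (forall x, x < r_p -> reg s' x = reg s x) -> arr s' t_in = arr s t_in ->
     (forall u, u < N -> arr s' t_alive u = trim n B (arr s t_alive) u) -> Q s') ->
  wp K round s Q.
Proof.
move=> hs hQ; set X := arr s t_alive in hQ.
pose kept (s' : store) := [/\ forall x, x < r_p -> reg s' x = reg s x,
  arr s' t_in = arr s t_in & arr s' t_alive = X].
have kept_N s' : kept s' -> reg s' r_N = N by case=> h _ _; rewrite h // (env_N hs).
have hN := env_N hs.
apply: wp_seq; apply: (@wp_for _ _ _ _ (fun j s' => kept s' /\
  forall u, u < j -> arr s' t_hasin u = false /\ arr s' t_hasout u = false)) => //=.
- by rewrite hN.
- by split=> //; split=> //= x; case: (x =P r_i) => [->|].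
- rewrite hN => j s1 hj [[k1 k2 k3] h] e1 e2.
  apply: wp_seq; apply: wp_do => //; apply: wp_do => //=; split=> //; split.
    by split=> //= x hx; rewrite (ltn_eqF (leq_trans hx (isT : r_p <= r_i))) k1.
  move=> u; rewrite /= e1 ltnS leq_eqVlt => /orP[/eqP ->|hu]; first by rewrite eqxx.
  by rewrite (ltn_eqF hu); apply: h.
rewrite hN => s1 [k1 h] _ _; apply: wp_seq.
apply: (@wp_sweep _ (fun m s' => kept s' /\ forall u, u < N ->
  arr s' t_hasin u = has_in n B X u m /\ arr s' t_hasout u = has_out n B X u m)) => //.
- by case: k1 => -> // _ _; rewrite (env_B hs).
- exact: kept_N.
- move=> m s2 s3 [r1 r2] [[k2 k3 k4] h2]; rewrite /kept r2; split=> //; split=> // x hx.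
  by rewrite r1 // k2.
- move=> m s2 hm [[k2 k3 k4] h2] e1 e2; apply: (wp_on_edge e1 e2); rewrite k4 => he.
    apply: wp_seq; apply: wp_do => //; apply: wp_do => //=; split=> //.
    split=> // u hu; have [h3 h4] := h2 u hu.
    rewrite /= e1 e2 has_inS has_outS he !andbT h3 h4 !(eq_sym u).
    by split; case: ifP; rewrite ?orbT ?orbF.
  split=> //; split=> // u hu; have [h3 h4] := h2 u hu.
  by rewrite has_inS has_outS he !andbF !orbF h3 h4.
move=> s2 [k2 h2].
pose kept' (s' : store) := [/\ forall x, x < r_p -> reg s' x = reg s x,
  arr s' t_in = arr s t_in, arr s' t_hasin = arr s2 t_hasin &
  arr s' t_hasout = arr s2 t_hasout].
have trimE u : u < N -> trim n B X u = [&& X u, arr s2 t_hasin u & arr s2 t_hasout u].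
  by move=> /h2[-> ->].
apply: (@wp_for _ _ _ _ (fun j s' => kept' s' /\
  forall u, u < N -> arr s' t_alive u = if u < j then trim n B X u else X u)) => //=.
- by rewrite kept_N.
- case: k2 => k2 k3 k4; split; last by move=> u _; rewrite k4.
  by split=> // x hx; rewrite /= (ltn_eqF (leq_trans hx (isT : r_p <= r_i))) k2.
- rewrite kept_N // => j s3 hj [[k3 k4 k5 k6] h3] e1 e2.
  apply: wp_seq; apply: wp_clear_unless => // s4 r4 o4 a4.
  apply: wp_clear_unless => // s5 r5 o5 a5.
  rewrite /kept' /= !(r5, r4) e1 e2; split=> //; split.
    rewrite !(o5, o4) //; split=> // x hx.
    by rewrite (ltn_eqF (leq_trans hx (isT : r_p <= r_i))) k3.
  move=> u hu; rewrite a5 r4 a4 o4 // e1 h3 // k5 k6 ltnS.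
  case: (u =P j) => [->|/eqP hne]; first by rewrite ltnn leqnn trimE ?andbA // (leq_trans hj).
  by rewrite [u <= j]leq_eqVlt (negbTE hne).
move=> s3 [[k3 k4 _ _] h3] _ _; apply: hQ => // u hu.
by rewrite h3 // kept_N // hu.
Qed.

(** The array is controlled only in the cells below N; [eq_trim] ensures that trimming there depends
    on nothing else. *)
Lemma wp_rounds s (Q : store -> Prop) : env s ->
  (forall s', (forall x, x < r_u -> reg s' x = reg s x) -> arr s' t_in = arr s t_in ->
     (forall u, u < N -> arr s' t_alive u = iter N (trim n B) (arr s t_alive) u) -> Q s') ->
  wp K (For r_u r_N round) s Q.
Proof.
move=> hs hQ; have hN := env_N hs; set X := arr s t_alive in hQ.
apply: (@wp_for _ _ _ _ (fun j s' => [/\ forall x, x < r_u -> reg s' x = reg s x,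
  arr s' t_in = arr s t_in &
  forall u, u < N -> arr s' t_alive u = iter j (trim n B) X u])) => //=.
- by rewrite hN.
- by split=> // x hx; rewrite /= ltn_eqF.
- move=> j s1 hj [k1 k2 k3] e1 e2.
  apply: wp_round => [|s2 r1 r2 r3].
    by apply: env_regs hs => // x hx; apply: k1; apply: leq_trans hx _.
  rewrite !r1 //; split=> //; split; rewrite ?r2 //.
    by move=> x hx; rewrite /= ltn_eqF // r1 ?k1 // (leq_trans hx).
  by move=> u hu; rewrite /= r3 //; apply: eq_trim.
- by rewrite hN => s1 [k1 k2 k3] _ _; apply: hQ.
Qed.

Lemma wp_final s (Q : store -> Prop) : env s -> reg s r_ans = 0 ->
  (forall s', reg s' r_zero = 0 ->
     reg s' r_ans = merging n B (arr s t_alive) (B * N) -> Q s') ->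
  wp K final s Q.
Proof.
move=> hs h8 hQ; have hN := env_N hs; set X := arr s t_alive in hQ.
pose kept (s' : store) :=
  (forall x, x < r_p -> x != r_ans -> reg s' x = reg s x) /\ arr s' t_alive = X.
apply: wp_seq; apply: (@wp_for _ _ _ _ (fun j s' => [/\ kept s', reg s' r_ans = 0 &
  forall u, u < j -> arr s' t_hasin u = false])) => //=.
- by rewrite hN.
- by split=> //; split=> //= x; case: (x =P r_i) => [->|].
- rewrite hN => j s1 hj [[k1 k2] h3 h] e1 e2.
  apply: wp_do => //=; split=> //; split=> //.
    by split=> //= x hx hx'; rewrite (ltn_eqF (leq_trans hx (isT : r_p <= r_i))) k1.
  move=> u; rewrite /= e1 ltnS leq_eqVlt => /orP[/eqP ->|hu]; first by rewrite eqxx.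
  by rewrite (ltn_eqF hu); apply: h.
rewrite hN => s1 [[k1 k1'] h3 h] _ _.
have kE s' x : kept s' -> x < r_ans -> reg s' x = reg s x.
  by case=> k _ hx; apply: k; [apply: leq_trans hx _ | rewrite ltn_eqF].
apply: (@wp_sweep _ (fun m s' => [/\ kept s', reg s' r_ans = merging n B X m &
  forall u, u < N -> arr s' t_hasin u = has_in n B X u m])) => //.
- by rewrite k1 // (env_B hs).
- by rewrite k1.
- move=> m s2 s3 [r1 r2] [[k2 k3] h4 h5]; rewrite /kept r2; split=> //; last by rewrite r1.
  by split=> // x hx hx'; rewrite r1 // k2.
- move=> m s2 hm [[k2 k3] h4 h5] e1 e2; have hp := divB_lt B0 hm.
  apply: (wp_on_edge e1 e2); rewrite k3 => he.
    have hinE s' : arr s' = arr s2 -> reg s' r_p = reg s2 r_p -> forall u, u < N ->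
        arr (seta s' t_hasin (reg s' r_p) true) t_hasin u = has_in n B X u m.+1.
      move=> r1 r2 u hu; rewrite /= r2 r1 e1 has_inS he andbT h5 // (eq_sym u).
      by case: ifP; rewrite ?orbT ?orbF.
    apply: wp_seq; apply: wp_when => /=; rewrite e1 h5 // => hi.
      apply: wp_seq; apply: wp_do => //; apply: wp_do => /=; first by lia.
      apply: wp_do => //=; split.
        split; [|by rewrite mergingS he hi orbT|exact: hinE].
        by split=> //= x hx hx'; rewrite !(negbTE hx') k2.
      by move=> x; rewrite !inE => /or4P[/eqP->|/eqP->|/eqP->|/orP[]/eqP->].
    apply: wp_do => //=; split=> //; split=> //; last exact: hinE.
    by rewrite mergingS he h4 (negbTE (introN idP hi)) orbF.
  split=> //; split=> // [|u hu]; first by rewrite mergingS he orbF.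
  by rewrite has_inS he andbF orbF h5.
by move=> s2 [k2 h4 _]; apply: hQ => //; rewrite (kE s2) // (env_zero hs).
Qed.

End Trimming.

(** * Correctness of the decision program *)

Section Decide.

Variables (K n B base : nat) (na : nat -> nat) (w : seq bool).
Let N := nwords n B.

Hypothesis B0 : 0 < B.
Hypothesis na_lt : forall i, i <= n -> na i < B.
Hypothesis coef_true : forall i z, i <= n -> z < na i -> nth false w (offset base na i + z).
Hypothesis coef_end : forall i, i <= n -> nth false w (offset base na i + na i) = false.
Hypothesis K_offset : forall i, i <= n -> offset base na i + na i < K.
Hypothesis K_B : B + B <= K.
Hypothesis K_n : (n + n).+2 <= K.
Hypothesis K_BN : B * N <= K.

Lemma wp_decide s (Q : store -> Prop) : env n B base w s -> reg s r_ans = 0 ->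
  (forall s', reg s' r_zero = 0 ->
     reg s' r_ans = merging n B (alive n B na) (B * N) -> Q s') ->
  wp K decide s Q.
Proof.
move=> hs h8 hQ; have hN := env_N hs.
have K_N : N <= K by apply: leq_trans K_BN; rewrite leq_pmull.
apply: wp_seq; apply: (@wp_for _ _ _ _ (fun j s' => [/\ forall x, x < r_u -> reg s' x = reg s x,
  arr s' t_in = arr s t_in & forall u, u < j -> arr s' t_alive u = admissible n B na u])) => //=.
- by rewrite hN.
- by split=> // x hx; rewrite /= ltn_eqF.
- rewrite hN => j s1 hj [k1 k2 k3] e1 e2.
  have hs1 : env n B base w s1.
    by apply: env_regs hs => // x hx; apply: k1; apply: leq_trans hx _.
  apply: (wp_check (na := na) (B := B) (base := base) (n := n) (w := w)) => //.
    by rewrite e1 (leq_trans (ltnW hj)).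
  rewrite e1 => s2 r1 r2; rewrite !r1 // e1 e2; split=> //; split.
  + by move=> x hx; rewrite /= ltn_eqF // r1 ?k1 // (leq_trans hx).
  + by rewrite -k2; apply: functional_extensionality => z; rewrite /= r2.
  + move=> u; rewrite ltnS leq_eqVlt /= r2 /= => /orP[/eqP ->|hu]; first by rewrite eqxx.
    by rewrite ltn_eqF // k3.
rewrite hN => s1 [k1 k2 k3] _ _.
have hs1 : env n B base w s1.
  by apply: env_regs hs => // x hx; apply: k1; apply: leq_trans hx _.
apply: wp_seq; apply: (wp_rounds B0 K_BN hs1) => s2 r1 r2 r3.
have hs2 : env n B base w s2.
  by apply: env_regs hs1 => // x hx; apply: r1; apply: leq_trans hx _.
apply: (wp_final B0 K_BN hs2) => [|s3 h0 h3]; first by rewrite r1 // k1.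
apply: hQ => //; rewrite h3; congr (nat_of_bool _).
have aliveE u : u < N -> arr s2 t_alive u = alive n B na u.
  move=> hu; rewrite r3 // /alive -/N.
  suff H t v : v < N -> iter t (trim n B) (arr s1 t_alive) v =
      iter t (trim n B) (admissible n B na) v by exact: H.
  by elim: t v => [|t IH] v hv; [exact: k3 | apply: eq_trim].
have edgeE m : m < B * N -> edge n B (arr s2 t_alive) m = edge n B (alive n B na) m.
  by move=> hm; rewrite /edge !aliveE ?modN_lt ?divB_lt.
apply: eq_in_has => m; rewrite mem_iota /= add0n => hm; rewrite edgeE //; congr (_ && _).
apply: eq_in_has => m'; rewrite mem_iota /= add0n => hm'.
by rewrite edgeE // (ltn_trans hm').
Qed.

End Decide.

(** * Input and running time *)

Definition power_prog : prog :=
  Do (Inc r_N);;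
  For r_ct r_len (
    Do (Clr r_t);; For r_ct2 r_N (add r_t r_B r_ct3);; copy r_N r_t).

Lemma wp_power K s (Q : store -> Prop) : 0 < reg s r_B -> reg s r_N = 0 -> reg s r_len <= K ->
  reg s r_B ^ reg s r_len <= K ->
  (forall s', (forall x, x < r_arg -> x != r_N -> reg s' x = reg s x) -> arr s' = arr s ->
     reg s' r_N = reg s r_B ^ reg s r_len -> Q s') -> wp K power_prog s Q.
Proof.
move=> B0 hN hl hK hQ; set B := reg s r_B in B0 hK hQ; set L := reg s r_len in hl hK hQ.
have BK j : j <= L -> B ^ j <= K by move=> hj; apply: leq_trans hK; rewrite leq_pexp2l.
apply: wp_seq; apply: wp_do => /=; first by rewrite hN; have := BK 0 isT.
apply: (@wp_for _ _ _ _ (fun j s' => [/\ forall x, x < r_arg -> x != r_N -> reg s' x = reg s x,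
  arr s' = arr s & reg s' r_N = B ^ j])) => //=.
- split=> //; last by rewrite hN.
  by move=> x hx /negbTE hx'; rewrite /= hx' (ltn_eqF (leq_trans hx (isT : r_arg <= r_ct))).
- rewrite -/L => j s1 hj [k1 k2 k3] e1 e2.
  have hK1 : B ^ j * B <= K by rewrite -expnSr BK.
  apply: wp_seq; apply: wp_do => //; apply: wp_seq.
  apply: (@wp_for _ _ _ _ (fun c s' => same r_t s1 s' /\ reg s' r_t = c * B)) => //=.
  + by rewrite k3 BK // ltnW.
  + by split=> //; same_tac.
  + rewrite k3 => c s2 hc [h2 e3] e4 e5.
    have hB : reg s2 r_B = B by rewrite (proj1 h2) // k1.
    have hcK : c * B + B <= K.
      by apply: leq_trans hK1; rewrite -mulSnr leq_mul2r hc orbT.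
    apply: wp_add => //; rewrite hB e3 //; split=> //=.
    by split; [same_tac | rewrite /= mulSnr].
  rewrite k3 => s2 [h2 e3] e4 e5; apply: wp_copy => //; rewrite e3 //=.
  rewrite (proj1 h2) // (proj1 h2) //; split=> //; split=> /=.
  + move=> x hx /negbTE hx'; rewrite /= hx' (ltn_eqF (leq_trans hx (isT : r_arg <= r_ct))).
    by rewrite (proj1 h2) ?k1 ?hx' // (leq_trans hx).
  + by rewrite (proj2 h2).
  + by rewrite expnSr.
- by rewrite -/L => s1 [k1 k2 k3] _ _; apply: hQ.
Qed.

(** The scans stop at n and at n + 1 + M, so the coefficients begin at n + M + 2. The window length
    2n + 1 arises as (n + 1) + n. *)
Definition setup : prog :=
  scan r_n;; Do (Inc r_pos);; scan r_v;; Do (Inc r_pos);; copy r_base r_pos;;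
  copy r_n1 r_n;; Do (Inc r_n1);; copy r_B r_v;; Do (Inc r_B);;
  copy r_len r_n1;; add r_len r_n r_ct;; Do (Inc r_one);; power_prog.

Lemma wp_setup K n M w (Q : store -> Prop) :
  (forall z, z < n -> nth false w z) -> nth false w n = false ->
  (forall z, z < M -> nth false w (n.+1 + z)) -> nth false w (n.+1 + M) = false ->
  n + M + 2 <= K -> (n + n).+2 <= K -> nwords n M.+1 <= K ->
  (forall s, env n M.+1 (n + M + 2) w s -> reg s r_ans = 0 -> Q s) ->
  wp K setup (input_store t_in w) Q.
Proof.
move=> w1 w2 w3 w4 K1 K2 K3 hQ.
apply: wp_seq; apply: (wp_scan (m := n)) => //=; try lia.
apply: wp_seq; apply: wp_do => /=; first by lia.
apply: wp_seq; apply: (wp_scan (m := M)) => //=; try lia.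
apply: wp_seq; apply: wp_do => /=; first by lia.
apply: wp_seq; apply: wp_copy => //=; first by lia.
apply: wp_seq; apply: wp_copy => //=; first by lia.
apply: wp_seq; apply: wp_do => /=; first by lia.
apply: wp_seq; apply: wp_copy => //=; first by lia.
apply: wp_seq; apply: wp_do => /=; first by lia.
apply: wp_seq; apply: wp_copy => //=; first by lia.
apply: wp_seq; apply: wp_add => //=; first by lia.
apply: wp_seq; apply: wp_do => /=; first by lia.
have eL : n.+1 + n = n.*2.+1 by lia.
apply: wp_power => //=; rewrite ?add0n ?eL //; first by lia.
move=> s h1 h2 h3; apply: hQ; last by rewrite h1.
by split; try (by rewrite h1 //=; lia); [rewrite h3 /= ?eL | move=> z; rewrite h2].
Qed.

Lemma nth_unary p k q z : z <= k -> nth false (p ++ unary k ++ q) (size p + z) = (z < k).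
Proof.
move=> hz; rewrite nth_cat ltnNge leq_addr /= addKn nth_cat size_rcons size_nseq ltnS hz.
rewrite nth_rcons size_nseq nth_nseq; case: ltnP => // h.
by case: eqP.
Qed.

Lemma offset_size base na i :
  size (flatten [seq unary (na j) | j <- iota 0 i]) + base = offset base na i.
Proof.
elim: i => [//|i IH]; rewrite -[in iota _ _]addn1 iotaD map_cat flatten_cat size_cat /= -IH.
by rewrite cats0 size_rcons size_nseq add0n; lia.
Qed.

Lemma nth_encode_coef n M (a : nat -> Z) i z :
  let na j := Z.to_nat (a j) in
  i <= n -> z <= na i ->
  nth false (encode n M a) (offset (n + M + 2) na i + z) = (z < na i).
Proof.
move=> na hi hz; rewrite /encode.
have -> : iota 0 n.+1 = iota 0 i ++ i :: iota i.+1 (n - i).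
  by rewrite -[n.+1](@subnKC i) 1?ltnW // iotaD subSn.
rewrite map_cat flatten_cat /= !catA -catA -offset_size.
set p := (_ ++ _) ++ flatten _.
have -> : size (flatten [seq unary (na j) | j <- iota 0 i]) + (n + M + 2) = size p.
  by rewrite /p !size_cat !size_rcons !size_nseq addnC; congr (_ + _); lia.
exact: nth_unary.
Qed.

(** Y = X^(5n) bounds K + 1, so the total is at most a constant times Y^(d + 1), the extra factor
    being the time per instruction. The constant 7c + 9 is below X^(7c + 9), so the exponent stays
    linear in n with coefficients that depend on the program alone. *)
Lemma cost_bound n X p (K := X ^ (4 * n)) : 0 < n -> 6 <= X ->
  2 + (cost K p).+1 * (2 * K + 6) <= X ^ ((8 * len p + 18 + 5 * (depth p).+1) * n).
Proof.
move=> n0 X6; have X0 : 0 < X by lia.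
pose Y := X ^ (5 * n); pose c := len p; pose d := depth p.
have Y0 e : 0 < Y ^ e by rewrite !expn_gt0 X0.
have KY : K.+1 <= Y.
  have : 2 * K <= X * K by rewrite leq_mul2r; lia.
  have : X ^ (4 * n).+1 <= Y by rewrite leq_pexp2l; lia.
  by rewrite expnS -/K; lia.
have hcost : cost K p <= c * Y ^ d.
  apply: leq_trans (cost_poly K p) _; rewrite leq_mul2l -/d; apply/orP; right.
  by case: (posnP d) => [->|d0]; rewrite ?expn0 ?leq_exp2r.
have h1 : (cost K p).+1 <= c.+1 * Y ^ d by have := Y0 d; rewrite mulSn; lia.
have h2 : 2 * K + 6 <= 7 * Y by lia.
have h3 : 2 + (cost K p).+1 * (2 * K + 6) <= (7 * c + 9) * Y ^ d.+1.
  have := leq_mul h1 h2; have := Y0 d.+1; rewrite expnS; nia.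
apply: leq_trans h3 _; rewrite [in leqRHS]mulnDl expnD leq_mul //.
  apply: (@leq_trans (2 ^ (7 * c + 9))); first by rewrite ltnW // ltn_expl.
  apply: (@leq_trans (X ^ (7 * c + 9))); first by rewrite leq_exp2r; lia.
  by rewrite leq_pexp2l //; rewrite -/c; nia.
by rewrite /Y -expnM leq_pexp2l //; rewrite -/d; nia.
Qed.

Theorem theorem2 :
  exists (m : TM) (C : nat),
    forall (n M : nat) (a : nat -> Z),
      (1 <= n)%N ->
      (forall i : nat, (i <= n)%N -> (0 <= a i <= Z.of_nat M)%Z) ->
      a 0%N = 0%Z -> a n = 0%Z ->
      exists h : config m,
        run (((M + 2) * (n + 2)) ^ (C * n)) (init m (encode n M a)) = Some h /\
        (@tm_accept m (cstate h) <->
         exists y : Z -> R, ~ tperiodic y /\ tsatisfies n a y /\ tminimal n a y).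
Proof.
pose p := setup;; decide.
(* Registers 0 to 29 occur, hence 30 tracks. The answer is compared with the register that stays
   0. *)
exists (prog_machine 30 p r_ans r_zero t_in), (8 * len p + 18 + 5 * (depth p).+1).
move=> n M a n0 ha a0 an; set w := encode n M a.
(* X exceeds every position in the input, and the exponent 4n covers the (M + 1)^(2n + 2) edges
   because 2n + 2 <= 4n. *)
pose X := (M + 2) * (n + 2); pose K := X ^ (4 * n).
pose na i := Z.to_nat (a i).
have X6 : 6 <= X by rewrite /X; nia.
have X0 : 0 < X by lia.
have XK : X <= K by rewrite -[leqLHS]expn1 leq_pexp2l; lia.
have na_lt i : i <= n -> na i < M.+1 by move=> /ha; rewrite /na; lia.
have K_BN : M.+1 * nwords n M.+1 <= K.
  rewrite /nwords -expnS; apply: (@leq_trans (X ^ n.*2.+2)).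
    by rewrite leq_exp2r // /X; nia.
  by rewrite leq_pexp2l; lia.
have K_offset i : i <= n -> offset (n + M + 2) na i + na i < K.
  move=> hi; apply: leq_trans XK.
  have : offset (n + M + 2) na i <= n + M + 2 + i * M.+1.
    elim: i hi => [|i IH] hi /=; first by lia.
    by have := IH (ltnW hi); have := na_lt i (ltnW hi); nia.
  have := na_lt i hi; rewrite /X; nia.
have hwp : wp K p (input_store t_in w) (fun s => reg s r_zero = 0 /\
    reg s r_ans = merging n M.+1 (alive n M.+1 na) (M.+1 * nwords n M.+1)).
  have nthn z : z <= n -> nth false w z = (z < n).
    exact: (@nth_unary [::]).
  have nthM z : z <= M -> nth false w (n.+1 + z) = (z < M).
    move=> hz; rewrite -(@nth_unary (unary n) M (flatten [seq unary (na i) | i <- iota 0 n.+1])) //.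
    by rewrite size_rcons size_nseq.
  apply: wp_seq; apply: (@wp_setup _ n M).
  - by move=> z hz; rewrite nthn // ltnW.
  - by rewrite nthn // ltnn.
  - by move=> z hz; rewrite nthM // ltnW.
  - by rewrite nthM // ltnn.
  - by apply: leq_trans XK; rewrite /X; nia.
  - by apply: leq_trans XK; rewrite /X; nia.
  - by apply: leq_trans K_BN; rewrite leq_pmull.
  move=> s hs h8; apply: (wp_decide _ na_lt _ _ K_offset _ _ K_BN hs h8) => //.
  - by move=> i z hi hz; rewrite nth_encode_coef // ltnW.
  - by move=> i hi; rewrite nth_encode_coef // ltnn.
  - by apply: leq_trans XK; rewrite /X; nia.
  - by apply: leq_trans XK; rewrite /X; nia.
case: hwp => s he [s0 s8].
have hfuel : 2 + (cost K p).+1 * (2 * K + 6) <= X ^ ((8 * len p + 18 + 5 * (depth p).+1) * n).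
  exact: cost_bound.
have [//|//|//|//|h [hrun hacc]] :=
  @prog_machine_correct 30 p r_ans r_zero t_in K w s _ _ _ _ he _ hfuel.
exists h; split=> //; rewrite hacc s0 s8 (nonperiodic_merging n0 ha a0 an) -/na.
by case: merging.
Qed.
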